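(* Let $k>l$ be positive integers and $N\ge 4k-1$. Then there exist $k$ positive constants $D_{k,l}^j$ ($j=1,\dots,k$) such that for all $u\in C_c^\infty(\mathbb{H}^N\setminus\{o\})$ $$\int_{\mathbb{H}^N}|\nabla_r^k u|^2\,dv_{\mathbb{H}^N}-\Big(\frac{N-1}{2}\Big)^{2(k-l)}\int_{\mathbb{H}^N}|\nabla_r^l u|^2\,dv_{\mathbb{H}^N}\ \ge\ \sum_{j=1}^{k}D_{k,l}^j\int_{\mathbb{H}^N}\frac{u^2}{r^{2j}}\,dv_{\mathbb{H}^N}.$$ Moreover, the constants $D_{k,l}^k$ and $D_{k,l}^1$ are given by $$D_{k,l}^k=\begin{cases} D_{k-l,0}^{k-l}\,\zeta_{2(k-l),l/2}^0 & \text{if } l=2h,\ k>l,\\ D_{k-l-1,0}^{k-l-1}\,\zeta_{2(k-l-1),(l+1)/2}^0 & \text{if } k=2m,\ l=2h+1,\ m-h\ne1,\\ \frac{(N-4)^2}{16}\,\zeta_{4,(l-1)/2}^0 & \text{if } k=2h+2,\ l=2h+1,\\ \frac14\,\zeta_{2,(k-1)/2}^0 & \text{if } k=2m+1,\ l=2h+1,\end{cases}$$ and $$D_{k,l}^1=\begin{cases} D_{k-l,0}^{1}\,\zeta_{2,l/2}^l & \text{if } l=2h,\ k>l,\\ \frac{(N-1)^{2k-2l-1}}{2^{2k-2l+1}}\,\zeta_{2,(l-1)/2}^{l-1}+D_{k-l-1,0}^1\,\zeta_{2,(l+1)/2}^{l+1} & \text{if } k=2m,\ l=2h+1,\ m-h\ne1,\\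 \frac{N-1}{8}\,\zeta_{2,(l-1)/2}^{l-1} & \text{if } k=2h+2,\ l=2h+1,\\ \frac14\,\zeta_{2,(k-1)/2}^{k-1}+\frac{(N-1)^2}{4}D_{k-1,l}^1 & \text{if } k=2m+1,\ l=2h+1,\ m-h\ne1,\\ \frac{(N-1)^3}{2^5}\,\zeta_{2,(l-1)/2}^{l-1}+\frac14\,\zeta_{2,(l+1)/2}^{l+1} & \text{if } k=2h+3,\ l=2h+1,\end{cases}$$ where in the fourth line $D_{k-1,l}^1$ is the value given by the second line for the pair $(k-1,l)$, and the quantities $D_{n,0}^n$, $D_{n,0}^1$, $\zeta_{\alpha,\beta}^0$, $\zeta_{\alpha,\beta}^{2\beta}$ are given by the explicit formulas in the context.
   Context: $\mathbb{H}^N$ is the $N$-dimensional hyperbolic space with a fixed pole $o$. In geodesic polar coordinates $x=(r,\sigma)\in(0,\infty)\times\mathbb{S}^{N-1}$ about $o$, with $r$ the geodesic distance from $x$ to $o$, the metric is $dr^2+\sinh^2 r\,d\omega^2$ and $dv_{\mathbb{H}^N}=(\sinh r)^{N-1}\,dr\,d\sigma$ is the volume element. The radial gradient and radial Laplacian are $$\nabla_r u=\Big(\frac{\partial u}{\partial r},0\Big),\quad |\nabla_r u|^2=\Big(\frac{\partial u}{\partial r}\Big)^2,\qquad \Delta_r u=\frac{\partial^2u}{\partial r^2}+(N-1)\coth r\,\frac{\partial u}{\partial r}.$$ For a non-negative integer $k$, $\nabla_r^k u=\Delta_r^{k/2}u$ if $k$ is even and $\nabla_r^k u=\nabla_r\Delta_r^{(k-1)/2}u$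 if $k$ is odd, where $\Delta_r^j$ is the $j$-th iterate of $\Delta_r$. The constants depend only on $N,k,l,j$, not on $u$. Explicit quantities (empty sums are $0$, empty products are $1$). For a positive integer $n$: $$D_{n,0}^n=\begin{cases}\big(\frac{N-4}{2^{2p}}\big)^2\prod_{j=1}^{p-1}(N+4j)^2(N-4j-4)^2 & n=2p,\\ \frac{1}{2^{4p+2}}\prod_{j=1}^{p}(N+4j-2)^2(N-4j-2)^2 & n=2p+1,\end{cases}$$ $$D_{n,0}^1=\begin{cases}\frac{N^2-1}{16}\sum_{j=1}^{p}\big(\frac{N-1}{2}\big)^{4p-2j-2} & n=2p,\\ (N^2-1)\sum_{j=1}^{p}\frac{(N-1)^{2p+2j-2}}{2^{2p+2j+2}}+\frac{(N-1)^{2p}}{2^{2p+2}} & n=2p+1.\end{cases}$$ For $\alpha\ge0$ and an integer $\beta\ge1$: $$\zeta_{\alpha,\beta}^0=\prod_{j=0}^{\beta-1}\frac{(N+\alpha+4j)^2(N-\alpha-4j-4)^2}{16},\qquad \zeta_{\alpha,\beta}^{2\beta}=4^\beta\Big(\frac{N-1}{4}\Big)^{2\beta},$$ and $\zeta_{\alpha,0}^0=1$. *)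

(* Defs.v *)
From HB Require Import structures.
From mathcomp Require Import all_boot all_order all_algebra.
From mathcomp Require Import all_classical all_reals all_analysis.
From mathcomp Require Import measurable_realfun.
Import Order.TTheory GRing.Theory Num.Theory.
Import numFieldNormedType.Exports.

Set Implicit Arguments.
Unset Strict Implicit.
Unset Printing Implicit Defensive.

Local Open Scope classical_set_scope.
Local Open Scope ring_scope.

Section lebesgue_cons.
Context (R : realType) (n : nat).
Variable m : {sigma_finite_measure set (n.-tuple (measurableTypeR R)) -> \bar R}.

Definition cons_pair (p : measurableTypeR R * n.-tuple (measurableTypeR R)) :
  n.+1.-tuple (measurableTypeR R) := [tuple of p.1 :: p.2].

Definition uncons_pair (t : n.+1.-tuple (measurableTypeR R)) :
    measurableTypeR R * n.-tuple (measurableTypeR R) :=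
  (thead t, [tuple of behead t]).

Lemma cons_pairK : cancel cons_pair uncons_pair.
Proof.
by move=> [a b]; congr pair; apply: val_inj.
Qed.

Lemma measurable_cons_pair : measurable_fun setT cons_pair.
Proof.
exact: measurable_cons measurable_fst measurable_snd.
Qed.

Lemma measurable_uncons_pair : measurable_fun setT uncons_pair.
Proof.
by apply: measurable_fun_pair; [exact: measurable_tnth | exact: measurable_behead].
Qed.

Definition lebesgue_cons : set (n.+1.-tuple (measurableTypeR R)) -> \bar R :=
  pushforward (lebesgue_measure \x m)%E cons_pair.

Let lebesgue_cons0 : lebesgue_cons set0 = 0%E.
Proof. by rewrite /lebesgue_cons /pushforward preimage_set0 measure0. Qed.

Let lebesgue_cons_ge0 A : (0 <= lebesgue_cons A)%E.
Proof. by rewrite /lebesgue_cons /pushforward; exact: measure_ge0. Qed.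

Let lebesgue_cons_additive : semi_sigma_additive lebesgue_cons.
Proof.
exact: (@measure_semi_sigma_additive _ _ _
  (measure_function_pushforward__canonical__measure_function_Measure
     _ measurable_cons_pair)).
Qed.

HB.instance Definition _ := isMeasure.Build _ _ _ lebesgue_cons
  lebesgue_cons0 lebesgue_cons_ge0 lebesgue_cons_additive.

Let lebesgue_cons_sigma_finite : sigma_finite setT lebesgue_cons.
Proof.
have /sigma_finiteP[F [TF ndF Foo]] := sigma_finiteT (@lebesgue_measure R).
have /sigma_finiteP[G [TG ndG Goo]] := sigma_finiteT m.
exists (fun i => uncons_pair @^-1` (F i `*` G i)).
  apply/esym; rewrite -subTset => t _.
  have [i _ Fi] : (\bigcup_i F i) (uncons_pair t).1 by rewrite -TF.
  have [j _ Gj] : (\bigcup_i G i) (uncons_pair t).2 by rewrite -TG.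
  exists (maxn i j) => //; split => /=.
  - have /subsetPset := ndF _ _ (leq_maxl i j); exact.
  - have /subsetPset := ndG _ _ (leq_maxr i j); exact.
move=> i; have [mFi Fi] := Foo i; have [mGi Gi] := Goo i.
have mFG : measurable (F i `*` G i) by exact: measurableX.
split; first by rewrite -[X in measurable X]setTI; exact: measurable_uncons_pair.
rewrite /lebesgue_cons /pushforward -comp_preimage.
have -> : (uncons_pair \o cons_pair) = id by apply/funext => p; exact: cons_pairK.
by rewrite preimage_id product_measure1E// lte_mul_pinfty// ge0_fin_numE.
Qed.

HB.instance Definition _ := @Measure_isSigmaFinite.Build _ _ _ lebesgue_cons
  lebesgue_cons_sigma_finite.

End lebesgue_cons.

Fixpoint lebesgue_tuple (R : realType) (n : nat) :
    {sigma_finite_measure set (n.-tuple (measurableTypeR R)) -> \bar R} :=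
  match n with
  | 0 => \d_([tuple] : 0.-tuple (measurableTypeR R))
  | n'.+1 => lebesgue_cons (lebesgue_tuple R n')
  end.

(** [sphere_measure N], the surface measure of the unit sphere, is a Borel
    measure on R^N carried by that sphere: its value on A is N times the
    Lebesgue measure of the cone {t | 0 < |t| <= 1 and t/|t| in A}. *)

Section sphere_measure.
Context (R : realType) (N : nat).
Implicit Type t : N.-tuple (measurableTypeR R).

Definition tuple_norm t : R := Num.sqrt (\sum_(i < N) tnth t i ^+ 2).

Definition tuple_dir t : N.-tuple (measurableTypeR R) :=
  [tuple tnth t i / tuple_norm t | i < N].

Definition punctured_ball := [set t | 0 < tuple_norm t <= 1].

Lemma measurable_tuple_norm : measurable_fun setT tuple_norm.
Proof.
apply: (@measurableT_comp _ _ _ _ _ _ (@Num.sqrt R)).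
  by apply: continuous_measurable_fun; exact: sqrt_continuous.
apply: measurable_sum => i; apply: measurable_funX; exact: measurable_tnth.
Qed.

Lemma measurable_punctured_ball : measurable punctured_ball.
Proof.
have -> : punctured_ball = tuple_norm @^-1` `]0, 1]%classic.
  by apply/seteqP; split => t; rewrite /preimage/= in_itv.
by rewrite -[X in measurable X]setTI; apply: measurable_tuple_norm.
Qed.

Lemma measurable_tuple_dir : measurable_fun setT tuple_dir.
Proof.
have mV : measurable_fun setT (@GRing.inv R).
  rewrite -(setvU [set 0 : R]); apply/measurable_funU => //; first exact: measurableC.
  split; last exact: measurable_fun_set1.
  apply: open_continuous_measurable_fun.
    exact/closed_openC/accessible_closed_set1/hausdorff_accessible/Rhausdorff.
  by move=> x; rewrite inE/= => /eqP x0; exact: inv_continuous.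
apply/measurable_fun_tnthP => i.
rewrite (_ : _ \o _ = fun t => tnth t i / tuple_norm t); last first.
  by apply/funext => t; rewrite /= tnth_mktuple.
apply: measurable_funM; first exact: measurable_tnth.
exact: measurableT_comp mV measurable_tuple_norm.
Qed.

Definition cone_measure : set (N.-tuple (measurableTypeR R)) -> \bar R :=
  pushforward (mrestr (lebesgue_tuple R N) measurable_punctured_ball) tuple_dir.

Let cone_measure0 : cone_measure set0 = 0%E.
Proof. by rewrite /cone_measure /pushforward preimage_set0 measure0. Qed.

Let cone_measure_ge0 A : (0 <= cone_measure A)%E.
Proof. by rewrite /cone_measure /pushforward; exact: measure_ge0. Qed.

Let cone_measure_additive : semi_sigma_additive cone_measure.
Proof.
exact: (@measure_semi_sigma_additive _ _ _
  (measure_function_pushforward__canonical__measure_function_Measure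
     _ measurable_tuple_dir)).
Qed.

HB.instance Definition _ := isMeasure.Build _ _ _ cone_measure
  cone_measure0 cone_measure_ge0 cone_measure_additive.

Definition sphere_measure : {measure set (N.-tuple (measurableTypeR R)) -> \bar R} :=
  mscale N%:R%:nng cone_measure.

End sphere_measure.

(** The exponential map at the pole o is a diffeomorphism of R^N onto H^N; we
    identify H^N with R^N through it (geodesic normal coordinates).  Then o is 0, the geodesic distance from
    x to o is the Euclidean norm |x|, and the polar coordinates (r, sigma) of a
    point x <> o are those of R^N: x = r sigma with |sigma| = 1. *)

Section hyperbolic.
Context (R : realType) (N : nat).
Notation HN := 'rV[R]_N.
Implicit Types (u : HN -> R) (x : HN) (r : R).

Definition dist_pole x : R := Num.sqrt (\sum_(i < N) x ord0 i ^+ 2).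

Definition polar r (sigma : N.-tuple (measurableTypeR R)) : HN :=
  \row_(i < N) (r * tnth sigma i).

Definition sinh r : R := (expR r - expR (- r)) / 2.
Definition cosh r : R := (expR r + expR (- r)) / 2.
Definition coth r : R := cosh r / sinh r.

Definition hyp_integral (F : HN -> R) : \bar R :=
  (\int[sphere_measure R N]_sigma
     \int[lebesgue_measure]_(r in `]0%R, +oo[)
       (F (polar r sigma) * sinh r ^+ N.-1)%:E)%E.

Definition iter_partial (s : seq 'I_N) u : HN -> R :=
  foldr (fun i v => 'D_(delta_mx ord0 i) v) u s.

Definition smooth u :=
  forall s : seq 'I_N, continuous (iter_partial s u) /\
    forall (i : 'I_N) x, derivable (iter_partial s u) x (delta_mx ord0 i).

(** Functions of C_c^oo(H^N \ {o}), extended by 0 to o. *)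
Definition test_function u :=
  let supp := closure [set x | u x != 0] in
  [/\ smooth u, compact supp & ~ supp 0].

(** At x = r sigma the vector x / |x| = sigma is the direction of the radial
    geodesic, so this is d/dr of r |-> u (r sigma). *)
Definition radial_deriv u : HN -> R :=
  fun x => 'D_((dist_pole x)^-1 *: x) u x.

Definition radial_laplacian u : HN -> R := fun x =>
  radial_deriv (radial_deriv u) x +
  (N.-1)%:R * coth (dist_pole x) * radial_deriv u x.

(** For odd k, [nabla_r k u] is the radial component of the vector nabla_r^k u,
    whose other component is 0; in all cases |nabla_r^k u|^2 is the square of
    [nabla_r k u]. *)
Definition nabla_r (k : nat) u : HN -> R :=
  if odd k then radial_deriv (iter k./2 radial_laplacian u)
  else iter k./2 radial_laplacian u.

Definition energy (k : nat) u : \bar R :=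
  hyp_integral (fun x => nabla_r k u x ^+ 2).

Definition hardy_term (j : nat) u : \bar R :=
  hyp_integral (fun x => u x ^+ 2 / dist_pole x ^+ (2 * j)).

End hyperbolic.

Section constants.
Context (R : realType) (N : nat).
Local Notation n_ := (N%:R : R).

(** D_{n,0}^n, with n = 2p or n = 2p + 1 *)
Definition D0_top (n : nat) : R :=
  let p := n./2 in
  if odd n then
    (2 ^+ (4 * p + 2))^-1 *
    \prod_(1 <= j < p.+1)
      ((n_ + 4 * j%:R - 2) ^+ 2 * (n_ - 4 * j%:R - 2) ^+ 2)
  else
    ((n_ - 4) / 2 ^+ (2 * p)) ^+ 2 *
    \prod_(1 <= j < p) ((n_ + 4 * j%:R) ^+ 2 * (n_ - 4 * j%:R - 4) ^+ 2).

(** D_{n,0}^1, with n = 2p or n = 2p + 1 *)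
Definition D0_one (n : nat) : R :=
  let p := n./2 in
  if odd n then
    (n_ ^+ 2 - 1) *
      \sum_(1 <= j < p.+1)
        ((n_ - 1) ^+ (2 * p + 2 * j - 2) / 2 ^+ (2 * p + 2 * j + 2)) +
    (n_ - 1) ^+ (2 * p) / 2 ^+ (2 * p + 2)
  else
    (n_ ^+ 2 - 1) / 16 *
      \sum_(1 <= j < p.+1) ((n_ - 1) / 2) ^+ (4 * p - 2 * j - 2).

(** zeta_{alpha,beta}^0 *)
Definition zeta_zero (alpha beta : nat) : R :=
  \prod_(0 <= j < beta)
    ((n_ + alpha%:R + 4 * j%:R) ^+ 2 * (n_ - alpha%:R - 4 * j%:R - 4) ^+ 2 / 16).

(** zeta_{alpha,beta}^{2 beta}; it does not depend on alpha *)
Definition zeta_top (alpha beta : nat) : R :=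
  4 ^+ beta * ((n_ - 1) / 4) ^+ (2 * beta).

(** D_{k,l}^k for k > l.  When l is odd, the cases k = l + 1 (k even) and
    k = l + 2 (k odd) are those written m - h = 1 with k = 2m or k = 2m + 1 and
    l = 2h + 1. *)
Definition D_top (k l : nat) : R :=
  if ~~ odd l then D0_top (k - l) * zeta_zero (2 * (k - l)) l./2
  else if odd k then 4^-1 * zeta_zero 2 (k.-1)./2
  else if k == l.+1 then (n_ - 4) ^+ 2 / 16 * zeta_zero 4 (l.-1)./2
  else D0_top (k - l - 1) * zeta_zero (2 * (k - l - 1)) (l.+1)./2.

(** D_{k,l}^1 for k even, l odd, k > l + 1 *)
Definition D_one_even_odd (k l : nat) : R :=
  (n_ - 1) ^+ (2 * k - 2 * l - 1) / 2 ^+ (2 * k - 2 * l + 1) *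
    zeta_top 2 (l.-1)./2 +
  D0_one (k - l - 1) * zeta_top 2 (l.+1)./2.

(** D_{k,l}^1 for k > l *)
Definition D_one (k l : nat) : R :=
  if ~~ odd l then D0_one (k - l) * zeta_top 2 l./2
  else if ~~ odd k then
    if k == l.+1 then (n_ - 1) / 8 * zeta_top 2 (l.-1)./2
    else D_one_even_odd k l
  else
    if k == l.+2 then
      (n_ - 1) ^+ 3 / 2 ^+ 5 * zeta_top 2 (l.-1)./2 +
      4^-1 * zeta_top 2 (l.+1)./2
    else
      4^-1 * zeta_top 2 (k.-1)./2 +
      (n_ - 1) ^+ 2 / 4 * D_one_even_odd k.-1 l.

End constants.

(* Main.v *)
Require Import Defs.
From mathcomp Require Import all_boot all_order all_algebra.
From mathcomp Require Import all_classical all_reals all_analysis.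
From mathcomp Require Import measurable_realfun.
From mathcomp Require Import ring lra zify.
Import Order.TTheory GRing.Theory Num.Theory.
Import numFieldNormedType.Exports.
Set Implicit Arguments.
Unset Strict Implicit.
Unset Printing Implicit Defensive.
Local Open Scope classical_set_scope.
Local Open Scope ring_scope.

(** Fix a unit vector [sigma] and put [f r = u (r sigma)], a smooth function with
    compact support in [(0, +oo)].  On such functions [nabla_r] acts as the
    derivative and [Delta_r] as [L f = f'' + (N - 1) coth r f'], so the theorem is
    an inequality on the half-line with the weight [(sinh r)^(N-1)], integrated
    over the sphere.  Write [q = (N - 1) / 2], [E f] for the integral of [f'^2]
    and [H j f] for that of [f^2 / r^(2 j)].  Everything follows from three
    inequalities:
    - Poincare-Hardy, [E f >= q^2 H 0 f + 1/4 H 1 f];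
    - its second order form,
      [H 0 (L f) >= q^2 E f + (N - 4)^2/16 H 2 f + (N - 1)/8 H 1 f];
    - a weighted Rellich inequality, valid as long as
      [C = (N + 2 j) (N - 2 j - 4) / 4] is nonnegative,
      [H j (L f) >= C^2 H (j + 2) f + 2 q C H (j + 1) f + q^2 H j f].

    Each of them comes from writing the difference of the two integrands as a sum
    of nonnegative terms and an exact derivative ([half_integral_le]); the terms are
    squares, and multiples of [f^2] or [f'^2] that are nonnegative thanks to a lower
    bound for the hyperbolic cotangent: [coth r >= 1] for the first,
    [coth r >= 1/r] for the third and the finer [coth r >= 1/r + r/(r + 3)] for
    the second.

    The passage to arbitrary [k > l] is bookkeeping.  A difference of energies is
    telescoped into differences of adjacent orders, to which the first two
    inequalities apply with [f] replaced by an iterate of [L]; the resulting terms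
    [H j (L^b f)] are then pushed down to [f] by the third, which spreads each
    weight [r^(-2 j)] over all weights from [r^(-2 j)] to [r^(-2 (j + 2 b))].  The
    extreme coefficients multiply to [zeta_top] and [zeta_zero], and all those in
    between are positive ([hardy_bound_energy]).

    The rest justifies the reduction to one variable.  Continuous partial
    derivatives give directional derivatives along every [sigma]
    ([has_line_der_sum]), whence [r |-> u (r sigma)] is smooth with all its
    derivatives bounded uniformly in [sigma] ([polar_family_smooth]), and this
    persists under [L] because [coth' = 1 - coth^2].  Uniform bounds and the
    finiteness of the surface measure make the energies finite, so that the
    pointwise inequality may be integrated over the sphere and the lower energy
    subtracted ([integrate_hardy_bound]). *)

(** * Combining inequalities between energies of different orders *)

Section abstract_hardy.
Context (R : realType) (N K : nat).
Hypotheses (K_ge2 : (2 <= K)%N) (N_ge : (4 * K - 1 <= N)%N).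
Local Notation n_ := (N%:R : R).
Local Notation q := ((n_ - 1) / 2).

(** Its square is the Euclidean Rellich constant, between the weights [r^(-2 j)] and
    [r^(-2 j - 4)], for the radial Laplacian. *)
Definition rellich_const (j : nat) : R :=
  (n_ + 2 * j%:R) * (n_ - 2 * j%:R - 4) / 4.

(* [X] stands for the functions of [r], [P] for the smooth ones with compact
   support, [L] for the radial Laplacian, [H j f] for the integral of
   [f^2 / r^(2 j)] and [E f] for that of [f'^2]. *)
Context (X : Type) (P : X -> Prop) (L : X -> X).
Context (H : nat -> X -> R) (E : X -> R).
Hypothesis PL : forall f, P f -> P (L f).
Hypothesis poincare_hardy : forall f, P f ->
  q ^+ 2 * H 0 f + 4^-1 * H 1 f <= E f.
Hypothesis rellich_gradient : forall f, P f ->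
  q ^+ 2 * E f + (n_ - 4) ^+ 2 / 16 * H 2 f + (n_ - 1) / 8 * H 1 f
    <= H 0 (L f).
Hypothesis weighted_rellich : forall j f, P f -> (j + 2 <= K)%N ->
  rellich_const j ^+ 2 * H j.+2 f + 2 * q * rellich_const j * H j.+1 f
    + q ^+ 2 * H j f <= H j (L f).

Let n_ge7 : 7 <= n_.
Proof. by rewrite (ler_nat _ 7 N); lia. Qed.

Let q_gt0 : 0 < q. Proof. by move: n_ge7; lra. Qed.

Lemma rellich_const_gt0 j : (j + 2 <= K)%N -> 0 < rellich_const j.
Proof.
move=> jK; rewrite /rellich_const.
have : (2 * j + 5)%:R <= n_ by rewrite ler_nat; lia.
rewrite natrD natrM => hj; have j0 : 0 <= j%:R :> R by [].
by rewrite divr_gt0// mulr_gt0//; lra.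
Qed.

(** Only the two extreme coefficients have prescribed values.  They vanish outside
    [lo..hi] so that bounds over different ranges can be added. *)
Definition hardy_bound (Q : X -> R) (lo hi : nat) (cl ch : R) :=
  exists Z : nat -> R,
    [/\ forall j, if (lo <= j <= hi)%N then is_true (0 < Z j) else Z j = 0,
        forall f, P f -> \sum_(0 <= j < hi.+1) Z j * H j f <= Q f,
        Z lo = cl & Z hi = ch].

Lemma hardy_bound_le Q Q' lo hi cl ch :
  (forall f, P f -> Q f <= Q' f) ->
  hardy_bound Q lo hi cl ch -> hardy_bound Q' lo hi cl ch.
Proof.
move=> QQ' [Z [Zpos ZQ Zlo Zhi]]; exists Z; split=> // f Pf.
exact: le_trans (ZQ f Pf) (QQ' f Pf).
Qed.

Lemma hardy_bound_add Q1 Q2 a lo hi1 hi2 cl1 cl2 ch1 ch2 :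
  0 < a -> (lo <= hi2 < hi1)%N ->
  hardy_bound Q1 lo hi1 cl1 ch1 -> hardy_bound Q2 lo hi2 cl2 ch2 ->
  hardy_bound (fun f => Q1 f + a * Q2 f) lo hi1 (cl1 + a * cl2) ch1.
Proof.
move=> a0 /andP[lohi hi21] [Z [Zpos ZQ Zlo Zhi]] [Y [Ypos YQ Ylo Yhi]].
exists (fun j => Z j + a * Y j); split.
- move=> j; have := Zpos j; have := Ypos j.
  case: (boolP (lo <= j <= hi1)%N); case: (boolP (lo <= j <= hi2)%N).
  + by move=> _ _ Yj Zj; rewrite addr_gt0// mulr_gt0.
  + by move=> _ _ -> Zj; rewrite mulr0 addr0.
  + lia.
  + by move=> _ _ -> ->; rewrite mulr0 addr0.
- move=> f Pf.
  rewrite (eq_bigr (fun j => Z j * H j f + a * (Y j * H j f))); last first.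
    by move=> j _; ring.
  rewrite big_split/= -mulr_sumr lerD ?ZQ// ler_pM2l//.
  suff <- : \sum_(0 <= j < hi2.+1) Y j * H j f = \sum_(0 <= j < hi1.+1) Y j * H j f.
    exact: YQ.
  rewrite [RHS](big_cat_nat (n := hi2.+1))//=; last by lia.
  rewrite [X in _ = _ + X]big_nat [X in _ = _ + X]big1 ?addr0// => j hj.
  by have := Ypos j; rewrite ifN => [->|]; [rewrite mul0r|lia].
- by rewrite Zlo Ylo.
- by have := Ypos hi1; rewrite ifN => [->|]; [rewrite mulr0 addr0|lia].
Qed.

(** The coefficients that replace [Z] when each [H j (L f)] is bounded below by the
    weighted Rellich inequality. *)
Definition rellich_shift (Z : nat -> R) (j : nat) : R :=
  match j with
  | 0 => 0
  | 1 => 2 * q * rellich_const 0 * Z 0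
  | j'.+2 => rellich_const j' ^+ 2 * Z j'
             + 2 * q * rellich_const j'.+1 * Z j'.+1
  end + q ^+ 2 * Z j.

Lemma hardy_bound_laplacian Q lo hi cl ch :
  (lo <= hi)%N -> (hi + 2 <= K)%N -> hardy_bound Q lo hi cl ch ->
  hardy_bound (fun f => Q (L f)) lo hi.+2
    (q ^+ 2 * cl) (rellich_const hi ^+ 2 * ch).
Proof.
move=> lohi hiK [Z [Zpos ZQ Zlo Zhi]].
have Z0 j : ~~ (lo <= j <= hi)%N -> Z j = 0.
  by move=> nj; have := Zpos j; rewrite (negbTE nj).
have Zge0 j : 0 <= Z j.
  by have := Zpos j; case: ifP => [_ /ltW|_ ->].
have Cge0 j : (j <= hi)%N -> 0 < rellich_const j.
  by move=> jhi; apply: rellich_const_gt0; lia.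
have T2 j : 0 <= rellich_const j ^+ 2 * Z j by rewrite mulr_ge0// sqr_ge0.
have T1 j : 0 <= 2 * q * rellich_const j * Z j.
  case: (leqP j hi) => jhi.
    rewrite mulr_ge0// mulr_ge0 ?(ltW (Cge0 _ jhi))//.
    by rewrite mulr_ge0// ltW.
  by rewrite Z0 ?mulr0//; lia.
have T0 j : 0 <= q ^+ 2 * Z j by rewrite mulr_ge0// sqr_ge0.
exists (rellich_shift Z); split.
- move=> j; case: ifPn => [/andP[loj jhi]|nj].
    have [jle|jgt] := leqP j hi.
      have Zj : 0 < q ^+ 2 * Z j.
        rewrite mulr_gt0 ?exprn_gt0//.
        by have := Zpos j; rewrite loj jle.
      rewrite /rellich_shift ltr_wpDl//; case: (j) => [|[|i]]//.
      by rewrite addr_ge0.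
    rewrite /rellich_shift ltr_pwDl//; case: j loj jhi jgt => [|[|i]]//.
      move=> lo1 hi1; rewrite ltnS leqn0 => /eqP hi0.
      rewrite mulr_gt0//; last by have := Zpos 0%N; rewrite ifT//; lia.
      by rewrite mulr_gt0 ?Cge0// mulr_gt0.
    rewrite !ltnS => lo1 hi1 hi2.
    have [ile|igt] := leqP lo i.
      rewrite ltr_pwDl// mulr_gt0//; last by have := Zpos i; rewrite ifT//; lia.
      by rewrite exprn_gt0 ?Cge0.
    rewrite ltr_wpDl// mulr_gt0//; last by have := Zpos i.+1; rewrite ifT//; lia.
    by rewrite mulr_gt0 ?Cge0//; [rewrite mulr_gt0|lia].
  rewrite /rellich_shift.
  case: j nj => [|[|i]] nj.
  + by rewrite Z0 ?mulr0 ?addr0//; lia.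
  + by rewrite (Z0 0%N) ?(Z0 1%N) ?mulr0 ?addr0//; lia.
  + by rewrite (Z0 i) ?(Z0 i.+1) ?(Z0 i.+2) ?mulr0 ?addr0//; lia.
- move=> f Pf; apply: le_trans (ZQ _ (PL Pf)).
  pose S2 := \sum_(0 <= j < hi.+1) rellich_const j ^+ 2 * Z j * H j.+2 f.
  pose S1 := \sum_(0 <= j < hi.+1) 2 * q * rellich_const j * Z j * H j.+1 f.
  pose S0 := \sum_(0 <= j < hi.+1) q ^+ 2 * Z j * H j f.
  apply: (@le_trans _ _ (S2 + S1 + S0)); last first.
    rewrite /S2 /S1 /S0 -!big_split/= !big_mkord; apply: ler_sum => j _.
    have -> : rellich_const j ^+ 2 * Z j * H j.+2 f +
        2 * q * rellich_const j * Z j * H j.+1 f + q ^+ 2 * Z j * H j f =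
      Z j * (rellich_const j ^+ 2 * H j.+2 f +
        2 * q * rellich_const j * H j.+1 f + q ^+ 2 * H j f) by ring.
    by rewrite ler_wpM2l// weighted_rellich//; have := ltn_ord j; lia.
  have e2 : \sum_(0 <= j < hi.+3)
      (if j is i.+2 then rellich_const i ^+ 2 * Z i else 0) * H j f = S2.
    by rewrite 2?big_nat_recl//= !mul0r !add0r.
  have e1 : \sum_(0 <= j < hi.+3)
      (if j is i.+1 then 2 * q * rellich_const i * Z i else 0) * H j f = S1.
    rewrite big_nat_recl//= mul0r add0r big_nat_recr//= (Z0 hi.+1) ?mulr0 ?mul0r ?addr0//.
    by lia.
  have e0 : \sum_(0 <= j < hi.+3) q ^+ 2 * Z j * H j f = S0.
    rewrite 2?big_nat_recr//= (Z0 hi.+1) ?(Z0 hi.+2) ?mulr0 ?mul0r ?addr0//; lia.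
  rewrite -e2 -e1 -e0 -!big_split/= le_eqVlt; apply/orP; left; apply/eqP.
  by apply: eq_bigr => -[|[|j]] _; rewrite /rellich_shift; ring.
- rewrite /rellich_shift -Zlo -[RHS]add0r; congr (_ + _).
  case: lo lohi {Zlo} Z0 {Zpos} => [|[|i]] lohi Z0//.
    by rewrite Z0 ?mulr0//.
  by rewrite (Z0 i) ?(Z0 i.+1) ?mulr0 ?addr0//; lia.
- by rewrite /rellich_shift (Z0 hi.+1) ?(Z0 hi.+2) ?mulr0 ?addr0 ?Zhi//; lia.
Qed.

Lemma zeta_topE a b : zeta_top R N a b = q ^+ (2 * b).
Proof.
rewrite /zeta_top exprM [in RHS]exprM -exprMn; congr (_ ^+ b).
by field.
Qed.

Lemma zeta_topS a b : zeta_top R N a b.+1 = q ^+ 2 * zeta_top R N a b.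
Proof. by rewrite !zeta_topE -exprD; congr (_ ^+ _); lia. Qed.

Lemma zeta_zeroS a b : zeta_zero R N (2 * a) b.+1 =
  zeta_zero R N (2 * a) b * rellich_const (a + 2 * b) ^+ 2.
Proof.
rewrite /zeta_zero big_nat_recr//=; congr (_ * _).
by rewrite /rellich_const natrD !natrM; field.
Qed.

(** Every application of [L] moves the top weight up by [r^-4], with the factor
    [rellich_const ^+ 2] taken at the current top index, and leaves the bottom
    weight in place with the factor [q ^+ 2]. *)
Lemma hardy_bound_iter_laplacian Q lo hi cl ch b :
  (lo <= hi)%N -> (hi + 2 * b <= K)%N -> hardy_bound Q lo hi cl ch ->
  hardy_bound (fun f => Q (iter b L f)) lo (hi + 2 * b)
    (cl * zeta_top R N 2 b) (ch * zeta_zero R N (2 * hi) b).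
Proof.
move=> lohi hiK QZ; elim: b hiK => [|b IH] hiK.
  by rewrite muln0 addn0 /zeta_top /zeta_zero big_nil !expr0 !mulr1.
have /IH{}IH : (hi + 2 * b <= K)%N by lia.
have -> : (hi + 2 * b.+1 = (hi + 2 * b).+2)%N by lia.
have [||] := hardy_bound_laplacian _ _ IH; [lia|lia|].
move=> Z [Zpos ZQ Zlo Zhi]; exists Z; split => //.
- by move=> f Pf; rewrite iterSr; exact: ZQ.
- by rewrite Zlo zeta_topS; ring.
- by rewrite Zhi zeta_zeroS; ring.
Qed.

Definition energy1 (n : nat) (f : X) : R :=
  if odd n then E (iter n./2 L f) else H 0 (iter n./2 L f).

Lemma energy1_even p f : energy1 p.*2 f = H 0 (iter p L f).
Proof. by rewrite /energy1 odd_double doubleK. Qed.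

Lemma energy1_odd p f : energy1 p.*2.+1 f = E (iter p L f).
Proof. by rewrite /energy1 /= odd_double uphalf_double. Qed.

Lemma hardy_bound_1_0 :
  hardy_bound (fun f => E f - q ^+ 2 * H 0 f) 1 1 4^-1 4^-1.
Proof.
exists (fun j => if j == 1%N then 4^-1 else 0); split => //.
- by case=> [|[|j]]//=; rewrite invr_gt0.
- move=> f Pf; rewrite 2?big_nat_recr//= big_nil.
  by have := poincare_hardy Pf; lra.
Qed.

Lemma hardy_bound_2_1 :
  hardy_bound (fun f => H 0 (L f) - q ^+ 2 * E f) 1 2
    ((n_ - 1) / 8) ((n_ - 4) ^+ 2 / 16).
Proof.
exists (fun j => match j with
  | 1%N => (n_ - 1) / 8 | 2%N => (n_ - 4) ^+ 2 / 16 | _ => 0 end); split => //.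
- case=> [|[|[|j]]]//=; first by rewrite divr_gt0//; move: n_ge7; lra.
  by rewrite divr_gt0// exprn_gt0//; move: n_ge7; lra.
- move=> f Pf; rewrite 3?big_nat_recr//= big_nil.
  by have := rellich_gradient Pf; lra.
Qed.

(** [H 0 (L f) - q^4 H 0 f = (H 0 (L f) - q^2 E f) + q^2 (E f - q^2 H 0 f)]. *)
Lemma hardy_bound_2_0 :
  hardy_bound (fun f => H 0 (L f) - q ^+ 4 * H 0 f) 1 2
    ((n_ ^+ 2 - 1) / 16) ((n_ - 4) ^+ 2 / 16).
Proof.
have q2 : 0 < q ^+ 2 by rewrite exprn_gt0.
have [//|Z [Zpos ZQ Zlo Zhi]] := hardy_bound_add q2 _ hardy_bound_2_1 hardy_bound_1_0.
exists Z; split => //.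
- by move=> f Pf; have := ZQ f Pf; rewrite (exprD q 2 2); lra.
- by rewrite Zlo; field.
Qed.

Lemma D0_one_evenS p : D0_one R N p.+1.*2 =
  (n_ ^+ 2 - 1) / 16 * zeta_top R N 2 p + q ^+ 4 * D0_one R N p.*2.
Proof.
rewrite /D0_one !odd_double !doubleK zeta_topE.
rewrite big_nat_recr//= mulrDr addrC; congr (_ + _).
  by congr (_ * _ ^+ _); lia.
rewrite mulrCA; congr (_ * _); rewrite mulr_sumr.
apply: eq_big_nat => j hj; rewrite -exprD; congr (_ ^+ _); lia.
Qed.

Lemma D0_one_odd p : D0_one R N p.*2.+1 =
  4^-1 * zeta_top R N 2 p + q ^+ 2 * D0_one R N p.*2.
Proof.
rewrite /D0_one /= odd_double uphalf_double doubleK/= zeta_topE addrC.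
congr (_ + _).
  rewrite expr_div_n exprD.
  by field.
rewrite [RHS]mulrCA -mulrA; congr (_ * _); rewrite mulr_sumr mulr_sumr.
rewrite big_nat_rev/=; apply: eq_big_nat => j hj; rewrite -exprD expr_div_n.
have -> : (2 * p + 2 * (1 + p.+1 - j.+1) - 2 = 2 + (4 * p - 2 * j - 2))%N by lia.
have -> : (2 * p + 2 * (1 + p.+1 - j.+1) + 2 = 2 + (4 * p - 2 * j - 2) + 4)%N by lia.
rewrite [2 ^+ (_ + 4)]exprD invfM (_ : 2 ^+ 4 = 16 :> R); last by rewrite -natrX.
by rewrite mulrA mulrC.
Qed.

Lemma D0_top_even p : D0_top R N p.+1.*2 =
  (n_ - 4) ^+ 2 / 16 * zeta_zero R N 4 p.
Proof.
rewrite /D0_top odd_double doubleK/= /zeta_zero.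
elim: p => [|p IH]; first by rewrite !big_geq// !mulr1 expr_div_n -exprM -natrX.
rewrite [in RHS]big_nat_recr//= [RHS]mulrA -IH [in LHS]big_nat_recr//= mulrA.
have -> : (2 * p.+2 = 2 * p.+1 + 2)%N by lia.
rewrite exprD !expr_div_n; set B := \prod_(_ <= _ < _) _.
have : (2 ^+ (2 * p.+1) : R) != 0 by rewrite expf_neq0.
move: (_ ^+ (2 * p.+1)) => t t0; rewrite -natr1; field.
by rewrite t0.
Qed.

Lemma D0_top_odd p : D0_top R N p.*2.+1 = 4^-1 * zeta_zero R N 2 p.
Proof.
rewrite /D0_top /= odd_double uphalf_double/= /zeta_zero.
elim: p => [|p IH]; first by rewrite !big_geq// !mulr1 -natrX.
rewrite [in RHS]big_nat_recr//= [RHS]mulrA -IH [in LHS]big_nat_recr//= mulrA.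
have -> : (4 * p.+1 + 2 = 4 * p + 2 + 4)%N by lia.
rewrite [2 ^+ (_ + 4)]exprD; set B := \prod_(_ <= _ < _) _.
have : (2 ^+ (4 * p + 2) : R) != 0 by rewrite expf_neq0.
move: (_ ^+ (4 * p + 2)) => t t0; rewrite -natr1; field.
by rewrite t0.
Qed.

(** Telescoping: the bound of [H 0 (L f)] against [q^4 H 0 f], taken at the last
    iterate but one, is added to [q^4] times the bound of lower order. *)
Lemma hardy_bound_even_0 p : (p.+1.*2 <= K)%N ->
  hardy_bound (fun f => H 0 (iter p.+1 L f) - q ^+ (2 * p.+1.*2) * H 0 f)
    1 p.+1.*2 (D0_one R N p.+1.*2) (D0_top R N p.+1.*2).
Proof.
elim: p => [|p IH] pK.
  have -> : D0_one R N 1.*2 = (n_ ^+ 2 - 1) / 16.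
    by rewrite /D0_one/= big_nat1 expr0 mulr1.
  rewrite D0_top_even /zeta_zero big_geq// mulr1; exact: hardy_bound_2_0.
have /IH{}IH : (p.+1.*2 <= K)%N by lia.
have h2 : (2 + 2 * p.+1 = p.+2.*2)%N by lia.
have hK : (2 + 2 * p.+1 <= K)%N by rewrite h2.
have B2 := hardy_bound_iter_laplacian (isT : 1 <= 2)%N hK hardy_bound_2_0.
have q4 : 0 < q ^+ 4 by rewrite exprn_gt0.
rewrite h2 in B2.
have [|Z [Zpos ZQ Zlo Zhi]] := hardy_bound_add q4 _ B2 IH; first by lia.
exists Z; split => //.
- move=> f Pf; apply: le_trans (ZQ f Pf) _.
  have -> : (2 * p.+2.*2 = 4 + 2 * p.+1.*2)%N by lia.
  rewrite [q ^+ (4 + _)]exprD -iterS; lra.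
- by rewrite Zlo [RHS]D0_one_evenS.
- by rewrite Zhi D0_top_even.
Qed.

(** One Poincare-Hardy step at the top iterate reduces the order to an even one. *)
Lemma hardy_bound_odd_0 p : (p.*2.+1 <= K)%N ->
  hardy_bound (fun f => E (iter p L f) - q ^+ (2 * p.*2.+1) * H 0 f)
    1 p.*2.+1 (D0_one R N p.*2.+1) (D0_top R N p.*2.+1).
Proof.
case: p => [|p] pK.
  rewrite D0_one_odd D0_top_odd /zeta_zero zeta_topE /D0_one/= !big_geq//.
  by rewrite !(mulr0, mulr1, addr0); exact: hardy_bound_1_0.
have h2 : (1 + 2 * p.+1 = p.+1.*2.+1)%N by lia.
have hK : (1 + 2 * p.+1 <= K)%N by rewrite h2.
have B1 := hardy_bound_iter_laplacian (isT : 1 <= 1)%N hK hardy_bound_1_0.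
have B2 := hardy_bound_even_0 (ltnW pK).
have q2 : 0 < q ^+ 2 by rewrite exprn_gt0.
rewrite h2 in B1.
have [|Z [Zpos ZQ Zlo Zhi]] := hardy_bound_add q2 _ B1 B2; first by lia.
exists Z; split => //.
- move=> f Pf; apply: le_trans (ZQ f Pf) _.
  have -> : (2 * p.+1.*2.+1 = 2 + 2 * p.+1.*2)%N by lia.
  rewrite [q ^+ (2 + _)]exprD; lra.
- by rewrite Zlo D0_one_odd.
- by rewrite Zhi D0_top_odd.
Qed.

Lemma hardy_bound_0 n : (0 < n <= K)%N ->
  hardy_bound (fun f => energy1 n f - q ^+ (2 * n) * H 0 f)
    1 n (D0_one R N n) (D0_top R N n).
Proof.
move=> /andP[n0 nK].
have [[p en]|[p en]] : (exists p, n = p.+1.*2) \/ (exists p, n = p.*2.+1).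
  by case: (boolP (odd n)) => on; [right; exists n./2|left; exists n./2.-1]; lia.
- subst n; apply: hardy_bound_le (hardy_bound_even_0 nK) => f _.
  by rewrite energy1_even.
- subst n; apply: hardy_bound_le (hardy_bound_odd_0 nK) => f _.
  by rewrite energy1_odd.
Qed.

(** For even [l] the energy of order [l] is [H 0] of an iterate of [L], at which the
    bound against [H 0] can be used. *)
Lemma hardy_bound_even_r k l : (0 < l < k)%N -> (k <= K)%N -> ~~ odd l ->
  hardy_bound (fun f => energy1 k f - q ^+ (2 * (k - l)) * energy1 l f)
    1 k (D_one R N k l) (D_top R N k l).
Proof.
move=> /andP[l0 lk] kK ol.
rewrite /D_one /D_top ol.
have el : (l = l./2.*2)%N by rewrite -[LHS]odd_double_half (negbTE ol).
have h : (k - l + 2 * l./2 = k)%N by lia.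
have hK : (k - l + 2 * l./2 <= K)%N by rewrite h.
have h1 : (1 <= k - l)%N by lia.
have [|Z [Zpos ZQ Zlo Zhi]] :=
  hardy_bound_iter_laplacian h1 hK (hardy_bound_0 _); first by lia.
rewrite h in Zpos ZQ Zhi; exists Z; split => // f Pf.
apply: le_trans (ZQ f Pf) _; rewrite {3}/energy1 (negbTE ol) /energy1.
have -> : odd (k - l) = odd k by rewrite oddB ?(negbTE ol) ?addbF//; lia.
by rewrite -!iterD (_ : (k - l)./2 + l./2 = k./2)%N//; lia.
Qed.

(** For [l = 2 h + 1] the difference is split at the even order [l + 1]: the upper
    part is a difference against [H 0 (L^(h+1) f)], the lower part is the second
    order inequality at [L^h f]. *)
Lemma hardy_bound_even_odd k l : (0 < l < k)%N -> (k <= K)%N ->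
  odd l -> ~~ odd k ->
  hardy_bound (fun f => energy1 k f - q ^+ (2 * (k - l)) * energy1 l f)
    1 k (D_one R N k l) (D_top R N k l).
Proof.
move=> /andP[l0 lk] kK ol ok; rewrite /D_one /D_top ol ok/= (negbTE ok).
have el : (l = l./2.*2.+1)%N by rewrite -[LHS]odd_double_half ol.
have ek : (k = k./2.*2)%N by rewrite -[LHS]odd_double_half (negbTE ok).
set h := l./2 in el *; set m := k./2 in ek *.
have -> : (l.-1)./2 = h by lia.
have -> : uphalf l = h.+1 by lia.
have hK : (2 + 2 * h <= K)%N by lia.
have [Y [Ypos YQ Ylo Yhi]] :=
  hardy_bound_iter_laplacian (isT : (1 <= 2)%N) hK hardy_bound_2_1.
case: ifPn => [/eqP kl|kl].
  have h2 : (2 + 2 * h = k)%N by lia.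
  rewrite h2 in Ypos YQ Yhi; exists Y; split => // f Pf.
  apply: le_trans (YQ f Pf) _; rewrite /energy1 ol (negbTE ok) -/h -/m.
  have -> : (2 * (k - l) = 2)%N by lia.
  by have -> : m = h.+1 by lia.
have d0 : (0 < k - l - 1 <= K)%N by lia.
have h1 : (1 <= k - l - 1)%N by lia.
have hK' : (k - l - 1 + 2 * h.+1 <= K)%N by lia.
have B1 := hardy_bound_iter_laplacian h1 hK' (hardy_bound_0 d0).
have e1 : (k - l - 1 + 2 * h.+1 = k)%N by lia.
rewrite e1 in B1.
have B2 : hardy_bound (fun f => H 0 (L (iter h L f)) - q ^+ 2 * E (iter h L f))
  1 (2 + 2 * h) ((n_ - 1) / 8 * zeta_top R N 2 h)
  ((n_ - 4) ^+ 2 / 16 * zeta_zero R N (2 * 2) h) by exists Y; split.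
have qd : 0 < q ^+ (2 * (k - l - 1)) by rewrite exprn_gt0.
have [|Z [Zpos ZQ Zlo Zhi]] := hardy_bound_add qd _ B1 B2; first by lia.
exists Z; split => //.
- move=> f Pf; apply: le_trans (ZQ f Pf) _.
  have -> : (2 * (k - l) = 2 * (k - l - 1) + 2)%N by lia.
  rewrite [q ^+ (_ + 2)]exprD /energy1 ol (negbTE ok) -/h -/m.
  have -> : odd (k - l - 1) = false by lia.
  rewrite -iterD -iterS.
  have -> : ((k - l - 1)./2 + h.+1 = m)%N by lia.
  lra.
- rewrite Zlo /D_one_even_odd.
  have -> : (l.-1)./2 = h by lia.
  have -> : (l.+1)./2 = h.+1 by lia.
  rewrite addrC; congr (_ + _); rewrite mulrA; congr (_ * _).
  have -> : (2 * k - 2 * l - 1 = 2 * (k - l - 1) + 1)%N by lia.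
  have -> : (2 * k - 2 * l + 1 = 2 * (k - l - 1) + 3)%N by lia.
  rewrite !exprD !expr_div_n.
  have : (2 ^+ (2 * (k - l - 1)) : R) != 0 by rewrite expf_neq0.
  move: (2 ^+ (2 * (k - l - 1))) => t t0; by field.
Qed.

(** When both orders are odd, a Poincare-Hardy step lowers [k] to an even order. *)
Lemma hardy_bound_energy k l : (0 < l < k)%N -> (k <= K)%N ->
  hardy_bound (fun f => energy1 k f - q ^+ (2 * (k - l)) * energy1 l f)
    1 k (D_one R N k l) (D_top R N k l).
Proof.
move=> lk kK; case: (boolP (odd l)) => ol; last exact: hardy_bound_even_r.
case: (boolP (odd k)) => ok; last exact: hardy_bound_even_odd.
have lk1 : (0 < l < k.-1)%N by lia.
have kK1 : (k.-1 <= K)%N by lia.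
have ok1 : ~~ odd k.-1 by lia.
have B2 := hardy_bound_even_odd lk1 kK1 ol ok1.
have ek : (k = k./2.*2.+1)%N by rewrite -[LHS]odd_double_half ok.
set m := k./2 in ek *.
have hm : (1 + 2 * m <= K)%N by lia.
have B1 := hardy_bound_iter_laplacian (isT : (1 <= 1)%N) hm hardy_bound_1_0.
have e1 : (1 + 2 * m = k)%N by lia.
rewrite e1 in B1.
have q2 : 0 < q ^+ 2 by rewrite exprn_gt0.
have [|Z [Zpos ZQ Zlo Zhi]] := hardy_bound_add q2 _ B1 B2; first by lia.
exists Z; split => //.
- move=> f Pf; apply: le_trans (ZQ f Pf) _.
  have -> : (2 * (k - l) = 2 + 2 * (k.-1 - l))%N by lia.
  rewrite [q ^+ (2 + _)]exprD.
  have -> : energy1 k f = E (iter m L f) by rewrite /energy1 ok.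
  have -> : energy1 k.-1 f = H 0 (iter m L f).
    by rewrite /energy1 (negbTE ok1); congr (H 0 (iter _ L f)); lia.
  lra.
- rewrite Zlo /D_one ol ok (negbTE ok1)/=.
  have -> : (k.-1)./2 = m by lia.
  have -> : (k.-1 == l.+1) = (k == l.+2) by lia.
  case: ifPn => [/eqP kl|_]; last by congr (_ + _ * _); field.
  have -> : m = (l.+1)./2 by lia.
  by rewrite addrC; congr (_ + _); field.
- rewrite Zhi /D_top ol ok/=.
  by have -> : (k.-1)./2 = m by lia.
Qed.

End abstract_hardy.

(** * Hyperbolic functions on the half-line *)

Section scalar_derivative_rules.
Context (R : realType).
Implicit Types (f g : R -> R) (x a b : R).

(** [is_derive] is a type class; wrapping it keeps instance resolution from
    computing a derivative in a form different from the announced one. *)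
Definition has_der x f a : Prop := is_derive x 1 f a.

Lemma der_eq x f a b : has_der x f a -> a = b -> has_der x f b.
Proof. by move=> fa <-. Qed.

Lemma der_cst x a : has_der x (fun=> a) 0.
Proof. exact: is_derive_cst. Qed.

Lemma der_add x f g a b : has_der x f a -> has_der x g b ->
  has_der x (fun t => f t + g t) (a + b).
Proof. by move=> *; exact: is_deriveD. Qed.

Lemma der_opp x f a : has_der x f a -> has_der x (fun t => - f t) (- a).
Proof. by move=> *; exact: is_deriveN. Qed.

Lemma der_mul x f g a b : has_der x f a -> has_der x g b ->
  has_der x (fun t => f t * g t) (a * g x + f x * b).
Proof.
move=> fa gb; apply: der_eq (is_deriveM fa gb : has_der _ _ _) _.
by rewrite addrC; congr (_ + _); exact: mulrC.
Qed.

Lemma der_exp x f a n : has_der x f a ->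
  has_der x (fun t => f t ^+ n) (n%:R * f x ^+ n.-1 * a).
Proof.
move=> fa; apply: der_eq.
  rewrite (_ : (fun t => f t ^+ n) = f ^+ n); first exact: is_deriveX fa.
  by apply/funext => t; elim: n => [|n IH]; rewrite ?expr0// !exprS IH.
by [].
Qed.

Lemma der_inv x f a : f x != 0 -> has_der x f a ->
  has_der x (fun t => (f t)^-1) (- (f x)^-1 ^+ 2 * a).
Proof. by move=> f0 fa; apply: der_eq (is_deriveV f0 fa : has_der _ _ _) _; rewrite exprVn. Qed.

Lemma der_continuous x f a : has_der x f a -> {for x, continuous f}.
Proof. by case=> df _; apply/differentiable_continuous/derivable1_diffP. Qed.

Lemma der_expR x f a : has_der x f a ->
  has_der x (fun t => expR (f t)) (expR (f x) * a).
Proof. by move=> fa; exact: is_derive1_comp (is_derive_expR _) fa. Qed.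

Lemma der_id x : has_der x (fun t : R => t) 1.
Proof. exact: is_derive_id. Qed.

Lemma der_sinh x : has_der x (@sinh R) (cosh x).
Proof.
rewrite /sinh.
apply: der_eq.
  apply: der_mul; last exact: der_cst.
  apply: der_add; first exact: is_derive_expR.
  by apply/der_opp/der_expR/der_opp/der_id.
by rewrite /cosh; ring.
Qed.

Lemma der_cosh x : has_der x (@cosh R) (sinh x).
Proof.
rewrite /cosh.
apply: der_eq.
  apply: der_mul; last exact: der_cst.
  apply: der_add; first exact: is_derive_expR.
  by apply/der_expR/der_opp/der_id.
by rewrite /sinh; ring.
Qed.

Lemma sinh_gt0 x : 0 < x -> 0 < sinh x.
Proof. by move=> x0; rewrite divr_gt0// subr_gt0 ltr_expR; lra. Qed.

Lemma der_coth x : 0 < x -> has_der x (@coth R) (1 - coth x ^+ 2).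
Proof.
move=> x0; have s0 : sinh x != 0 by rewrite gt_eqF// sinh_gt0.
rewrite /coth; apply: der_eq.
  by apply: der_mul; [exact: der_cosh|apply: (der_inv s0); exact: der_sinh].
by rewrite /coth; field.
Qed.

Lemma coth_gt1 x : 0 < x -> 1 < coth x.
Proof.
move=> x0; rewrite /coth ltr_pdivlMr ?sinh_gt0// mul1r.
by rewrite /cosh /sinh; have := expR_gt0 (- x); lra.
Qed.

(** Cross-multiplied, this says that
    [F x = (2 x - 3) e^(2 x) + 2 x^2 + 4 x + 3] is nonnegative; [F] and [F']
    vanish at 0, and [F'' = 4 + 4 (2 x - 1) e^(2 x)] is nonnegative because
    [e^(-2 x) >= 1 - 2 x]. *)
Lemma coth_ge x : 0 < x -> x^-1 + x / (x + 3) <= coth x.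
Proof.
have nd (f df : R -> R) : (forall t, has_der t f (df t)) ->
    (forall t, 0 <= t -> 0 <= df t) -> f 0 = 0 -> forall t, 0 <= t -> 0 <= f t.
  move=> fdf df0 f0 t t0; rewrite -f0.
  apply: (@ger0_derive1_ndecry _ f 0) => //.
  - by move=> s _; exact: (@ex_derive _ _ _ _ _ _ _ (fdf s)).
  - move=> s; rewrite in_itv/= andbT => /ltW s0.
    by rewrite derive1E (@derive_val _ _ _ _ _ _ _ (fdf s)) df0.
  - by apply: continuous_subspaceT => s; exact: der_continuous (fdf s).
pose F (t : R) := expR (2 * t) * (2 * t - 3) + (2 * t ^+ 2 + 4 * t + 3).
pose F1 (t : R) := expR (2 * t) * (4 * t - 4) + (4 * t + 4).
pose F2 (t : R) := expR (2 * t) * (8 * t - 4) + 4.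
have der_lin a b t : has_der t (fun s : R => a * s + b) a.
  apply: der_eq.
    by apply: der_add (der_cst _ _); apply: der_mul (der_cst _ _) (der_id _).
  by rewrite /=; ring.
have der_e t : has_der t (fun s => expR (2 * s)) (2 * expR (2 * t)).
  apply: der_eq.
    by apply/der_expR; apply: der_mul (der_cst _ _) (der_id _).
  by rewrite /=; ring.
have F2ge0 t : 0 <= t -> 0 <= F2 t.
  move=> t0; rewrite /F2.
  have := expR_ge1Dx (- (2 * t)); rewrite expRN => h.
  have e0 := expR_gt0 (2 * t).
  have : expR (2 * t) * (1 - 2 * t) <= 1.
    by rewrite -ler_pdivlMl// mulr1.
  lra.
have F1ge0 : forall t, 0 <= t -> 0 <= F1 t.
  apply: (nd _ F2) => //; last by rewrite /F1 mulr0 expR0; lra.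
  move=> t; apply: der_eq.
    by apply: der_add (der_lin _ _ _); apply: der_mul (der_e _) (der_lin _ _ _).
  by rewrite /F2 /=; ring.
have Fge0 : forall t, 0 <= t -> 0 <= F t.
  apply: (nd _ F1) => //; last by rewrite /F mulr0 expR0; lra.
  move=> t; apply: der_eq.
    apply: der_add; first exact: der_mul (der_e _) (der_lin _ _ _).
    apply: der_add (der_cst _ _); apply: der_add; last first.
      by apply: der_mul (der_cst _ _) (der_id _).
    by apply: der_mul (der_cst _ _) (der_exp _ (der_id _)).
  by rewrite /F1 /=; ring.
move=> x0; rewrite /coth ler_pdivlMr ?sinh_gt0//.
have E : expR x * expR (- x) = 1 by rewrite expRN divff// gt_eqF ?expR_gt0.
have := Fge0 x (ltW x0); rewrite /F.
have -> : expR (2 * x) = expR x * expR x by rewrite -expRD; congr expR; ring.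
have e0 := expR_gt0 (- x) => h.
have {}h : 0 <= expR (- x) * (expR x * expR x * (2 * x - 3) + (2 * x ^+ 2 + 4 * x + 3)).
  by rewrite mulr_ge0// ltW.
have {}h : 0 <= expR x * (2 * x - 3) + expR (- x) * (2 * x ^+ 2 + 4 * x + 3).
  apply: le_trans h _; rewrite le_eqVlt; apply/orP; left; apply/eqP.
  transitivity ((expR x * expR (- x)) * expR x * (2 * x - 3)
    + expR (- x) * (2 * x ^+ 2 + 4 * x + 3)); first by ring.
  by rewrite E mul1r.
have x3 : 0 < x + 3 by lra.
rewrite -subr_ge0.
have -> : cosh x - (x^-1 + x / (x + 3)) * sinh x =
  (expR x * (2 * x - 3) + expR (- x) * (2 * x ^+ 2 + 4 * x + 3)) / (2 * (x * (x + 3))).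
  by rewrite /cosh /sinh; field; rewrite !gt_eqF.
by rewrite divr_ge0// mulr_ge0// mulr_ge0// ltW.
Qed.

Lemma coth_geV x : 0 < x -> x^-1 <= coth x.
Proof.
by move=> x0; apply: le_trans (coth_ge x0); rewrite lerDl divr_ge0//; lra.
Qed.

Lemma der_inv_exp m x : 0 < x ->
  has_der x (fun t : R => t^-1 ^+ m) (- m%:R * x^-1 ^+ m.+1).
Proof.
move=> x0; apply: der_eq.
  by apply: der_exp; apply: der_inv (der_id x); rewrite gt_eqF.
by case: m => [|m] /=; [rewrite !mul0r oppr0 mul0r|rewrite !exprS; ring].
Qed.

End scalar_derivative_rules.

(** * Integration by parts on the half-line *)

Section half_line_integral.
Context (R : realType).
Local Notation mu := (@lebesgue_measure R).
Implicit Types f g G : R -> R.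

Definition half_integral g : R := Rintegral mu `]0, +oo[ g.

Definition cont_pos g := forall r : R, 0 < r -> {for r, continuous g}.

Definition vanish_off (a b : R) g := forall r : R, ~~ (a <= r <= b) -> g r = 0.

Lemma cont_pos_cst (c : R) : cont_pos (fun=> c).
Proof. by move=> r _; exact: cvg_cst. Qed.

Lemma cont_pos_add f g : cont_pos f -> cont_pos g ->
  cont_pos (fun r => f r + g r).
Proof. by move=> cf cg r r0; apply: cvgD; [exact: cf|exact: cg]. Qed.

Lemma cont_pos_opp f : cont_pos f -> cont_pos (fun r => - f r).
Proof. by move=> cf r r0; apply: cvgN; exact: cf. Qed.

Lemma cont_pos_mul f g : cont_pos f -> cont_pos g ->
  cont_pos (fun r => f r * g r).
Proof. by move=> cf cg r r0; apply: cvgM; [exact: cf|exact: cg]. Qed.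

Lemma cont_pos_exp f n : cont_pos f -> cont_pos (fun r => f r ^+ n).
Proof.
move=> cf; elim: n => [|n IH].
  by rewrite (_ : (fun r => _) = fun=> 1); [exact: cont_pos_cst|].
rewrite (_ : (fun r => _) = fun r => f r * f r ^+ n); first exact: cont_pos_mul.
by apply/funext => r; rewrite exprS.
Qed.

Lemma cont_pos_der f df : (forall r, 0 < r -> has_der r f (df r)) -> cont_pos f.
Proof. by move=> fdf r r0; exact: der_continuous (fdf r r0). Qed.

Section supported.
Context (a b : R).
Hypothesis a_gt0 : 0 < a.
Hypothesis a_le_b : a <= b.

Let ab_pos : `[a, b]%classic `<=` `]0, +oo[%classic.
Proof. by move=> r /=; rewrite !in_itv/= andbT => /andP[/(lt_le_trans a_gt0)]. Qed.

Let restrict_half g : vanish_off a b g -> g \_ `]0, +oo[ = g \_ `[a, b].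
Proof.
move=> g0; apply/funext => r; rewrite !patchE.
case: (boolP (r \in `[a, b]%classic)) => rab.
  by rewrite ifT// inE; apply: ab_pos; rewrite inE in rab.
case: ifP => // _; apply: g0; move: rab; rewrite notin_setE/= in_itv/=.
by move/negP.
Qed.

Lemma half_integrable g : cont_pos g -> vanish_off a b g ->
  mu.-integrable `]0, +oo[ (EFin \o g).
Proof.
move=> cg g0.
apply: (integrable_mkcond _ _).2 => //; rewrite restrict_EFin restrict_half//.
rewrite -restrict_EFin; apply: (integrable_mkcond _ _).1 => //.
apply: continuous_compact_integrable; first exact: segment_compact.
apply: continuous_in_subspaceT => r; rewrite inE/= => rab.
by apply: cg; have /= := ab_pos rab; rewrite in_itv/= andbT.
Qed.

Lemma half_integralE g : cont_pos g -> vanish_off a b g ->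
  (\int[mu]_(r in `]0%R, +oo[) (g r)%:E)%E = (half_integral g)%:E.
Proof.
move=> cg g0; rewrite /half_integral /Rintegral fineK//.
exact: integrable_fin_num (half_integrable cg g0).
Qed.

Lemma half_integralD f g : cont_pos f -> vanish_off a b f ->
  cont_pos g -> vanish_off a b g ->
  half_integral (fun r => f r + g r) = half_integral f + half_integral g.
Proof. by move=> *; rewrite /half_integral RintegralD//; exact: half_integrable. Qed.

Lemma half_integralZ c g : cont_pos g -> vanish_off a b g ->
  half_integral (fun r => c * g r) = c * half_integral g.
Proof. by move=> *; rewrite /half_integral RintegralZl//; exact: half_integrable. Qed.

(** The support stays away from both ends of the half-line, so the boundary terms
    are 0. *)
Lemma half_integral_derivative G dG : (forall r, 0 < r -> has_der r G (dG r)) ->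
  cont_pos dG -> vanish_off a b G -> vanish_off a b dG -> half_integral dG = 0.
Proof.
move=> GdG cdG G0 dG0; pose a' := a / 2; pose b' := b + 1.
have a'0 : 0 < a' by rewrite divr_gt0.
have a'a : a' < a by rewrite /a'; move: a_gt0; lra.
have bb' : b < b' by rewrite /b'; lra.
have ab' : a' < b' by apply: lt_trans a'a (le_lt_trans a_le_b bb').
have sub : `[a, b]%classic `<=` `[a', b']%classic.
  move=> r /=; rewrite !in_itv/= => /andP[ar rb].
  by rewrite (ltW (lt_le_trans a'a ar)) (ltW (le_lt_trans rb bb')).
have sub' : `[a', b']%classic `<=` `]0, +oo[%classic.
  by move=> r /=; rewrite !in_itv/= andbT => /andP[/(lt_le_trans a'0)].
rewrite /half_integral /Rintegral.
rewrite (_ : integral _ _ _ = \int[mu]_(r in `[a', b']) (dG r)%:E)%E; last first.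
  rewrite [LHS]integral_mkcond [RHS]integral_mkcond; apply: eq_integral => r _.
  rewrite !patchE; case: (boolP (r \in `[a', b']%classic)) => rab.
    by rewrite ifT// inE; apply: sub'; rewrite inE in rab.
  case: ifP => // _; rewrite dG0//; apply/negP => rab'.
  by move: rab; rewrite notin_setE => /(_ (sub r _)); apply; rewrite /= in_itv.
rewrite (@continuous_FTC2 _ dG G)//.
- rewrite !G0 ?subee//.
  + by rewrite negb_and -!ltNge ?bb' ?a'a ?orbT.
  + by rewrite negb_and -!ltNge ?bb' ?a'a ?orbT.
- apply: continuous_in_subspaceT => r; rewrite inE/= => rab.
  by apply: cdG; have /= := sub' _ rab; rewrite in_itv/= andbT.
- split.
  + move=> r; rewrite in_itv/= => /andP[ar _].
    by have [] := GdG r (lt_trans a'0 ar).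
  + apply: cvg_at_right_filter; exact: der_continuous (GdG _ a'0).
  + apply: cvg_at_left_filter.
    exact: der_continuous (GdG _ (lt_trans a'0 ab')).
- move=> r; rewrite in_itv/= => /andP[ar _]; rewrite derive1E.
  by have [_ ->] := GdG r (lt_trans a'0 ar).
Qed.

Lemma half_integral_lin c d f g : cont_pos f -> vanish_off a b f ->
  cont_pos g -> vanish_off a b g ->
  half_integral (fun r => c * f r + d * g r)
  = c * half_integral f + d * half_integral g.
Proof.
move=> cf f0 cg g0; rewrite half_integralD ?half_integralZ//.
- by apply: cont_pos_mul => //; exact: cont_pos_cst.
- by move=> r hr; rewrite f0// mulr0.
- by apply: cont_pos_mul => //; exact: cont_pos_cst.
- by move=> r hr; rewrite g0// mulr0.
Qed.

Lemma half_integral_mono f g : cont_pos f -> vanish_off a b f ->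
  cont_pos g -> vanish_off a b g -> (forall r, 0 < r -> f r <= g r) ->
  half_integral f <= half_integral g.
Proof.
move=> cf f0 cg g0 fg; apply: le_Rintegral => //.
- exact: half_integrable.
- exact: half_integrable.
- by move=> r /=; rewrite in_itv/= andbT; exact: fg.
Qed.

(** All the inequalities below are obtained in this way: up to an exact
    derivative, which integrates to 0, one integrand dominates the other
    pointwise. *)
Lemma half_integral_le f g G dG :
  cont_pos f -> vanish_off a b f -> cont_pos g -> vanish_off a b g ->
  (forall r, 0 < r -> has_der r G (dG r)) ->
  cont_pos dG -> vanish_off a b G -> vanish_off a b dG ->
  (forall r, 0 < r -> f r <= g r + dG r) ->
  half_integral f <= half_integral g.
Proof.
move=> cf f0 cg g0 GdG cdG G0 dG0 fg.
rewrite -[leRHS]addr0 -(half_integral_derivative GdG cdG G0 dG0).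
rewrite -half_integralD//; apply: half_integral_mono => //.
- exact: cont_pos_add.
- by move=> r rab; rewrite g0// dG0// addr0.
Qed.

End supported.
End half_line_integral.

(** * Three inequalities on the half-line *)

Ltac cont_pos_auto := first
  [ match goal with H : cont_pos ?f |- cont_pos ?f => exact H end
  | lazymatch goal with
  | |- cont_pos (fun r => @?f r + @?g r) =>
      apply: (@cont_pos_add _ f g); cbv beta; cont_pos_auto
  | |- cont_pos (fun r => @?f r * @?g r) =>
      apply: (@cont_pos_mul _ f g); cbv beta; cont_pos_auto
  | |- cont_pos (fun r => - (@?f r)) =>
      apply: (@cont_pos_opp _ f); cbv beta; cont_pos_auto
  | |- cont_pos (fun r => (@?f r) ^+ ?n) =>
      apply: (@cont_pos_exp _ f n); cbv beta; cont_pos_auto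
  | |- cont_pos (fun=> _) => exact: cont_pos_cst
  | |- cont_pos (fun r => ?f r) => change (cont_pos f); cont_pos_auto
  end].

Ltac der_auto := first
  [ match goal with H : forall r, is_true (0 < r) -> has_der r ?f _
      |- has_der ?r ?f _ => exact: H end
  | lazymatch goal with
  | |- has_der ?x (fun r => @?f r + @?g r) _ =>
      eapply (@der_add _ x f g); cbv beta; der_auto
  | |- has_der ?x (fun r => @?f r * @?g r) _ =>
      eapply (@der_mul _ x f g); cbv beta; der_auto
  | |- has_der ?x (fun r => - (@?f r)) _ =>
      eapply (@der_opp _ x f); cbv beta; der_auto
  | |- has_der ?x (fun r => (@?f r) ^+ ?n) _ =>
      eapply (@der_exp _ x f); cbv beta; der_auto
  | |- has_der _ (fun=> _) _ => exact: der_cst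
  end].

Definition vol (R : realType) (N : nat) (r : R) : R := sinh r ^+ N.-1.

Section volume_density.
Context (R : realType) (N : nat).
Hypothesis N_ge7 : (7 <= N)%N.
Local Notation n_ := (N%:R : R).
Local Notation q := ((n_ - 1) / 2).
Local Notation vol := (@vol R N).

Lemma q_ge3 : 3 <= q.
Proof.
by have : 7%:R <= n_; [rewrite ler_nat|lra]. Qed.

Lemma dim_pred : N.-1%:R = 2 * q.
Proof.
by rewrite -subn1 natrB; [field|lia]. Qed.

Lemma vol_ge0 r : 0 < r -> 0 <= vol r.
Proof. by move=> r0; rewrite exprn_ge0// ltW// sinh_gt0. Qed.

Lemma der_vol r : 0 < r -> has_der r vol (2 * q * coth r * vol r).
Proof.
move=> r0; apply: der_eq; first by apply: der_exp; exact: der_sinh.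
rewrite /vol -dim_pred /coth; have : (0 < N.-1)%N by lia.
case: (N.-1) => // n _ /=; rewrite exprS.
by field; rewrite gt_eqF// sinh_gt0.
Qed.

End volume_density.

Section half_line_inequalities.
Context (R : realType) (N : nat) (a b : R).
Hypotheses (a_gt0 : 0 < a) (a_le_b : a <= b) (N_ge7 : (7 <= N)%N).
Local Notation n_ := (N%:R : R).
Local Notation q := ((n_ - 1) / 2).
Local Notation vol := (@vol R N).

Let q_ge3 := q_ge3 R N_ge7.
Let dim_pred := dim_pred R N_ge7.
Let vol_ge0 := @vol_ge0 R N.
Let dcoth : forall r : R, 0 < r -> has_der r (@coth R) (1 - coth r ^+ 2) := @der_coth R.
Let dvol := @der_vol R N N_ge7.
Let dinv : forall r : R, 0 < r -> has_der r (fun t => t^-1) (- r^-1 ^+ 2).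
Proof.
by move=> r r0; apply: der_eq (der_inv _ (der_id r)) _; rewrite ?gt_eqF// mulr1.
Qed.
Let ccoth : cont_pos (@coth R). Proof. exact: cont_pos_der dcoth. Qed.
Let cvol : cont_pos vol. Proof. exact: cont_pos_der dvol. Qed.
Let cinv : cont_pos (fun r : R => r^-1). Proof. exact: cont_pos_der dinv. Qed.

Section one_function.
Context (f d1 : R -> R).
Hypotheses (df : forall r, 0 < r -> has_der r f (d1 r)) (cd1 : cont_pos d1).
Hypotheses (f0 : vanish_off a b f) (d10 : vanish_off a b d1).

Let cf : cont_pos f. Proof. exact: cont_pos_der df. Qed.

(** The excess [\int g (d1 + s f)^2 vol] is nonnegative, and expanding the
    square leaves the exact derivative of [g s f^2 vol]. *)
Lemma weighted_hardy (g g1 s s1 : R -> R) :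
  (forall r, 0 < r -> has_der r g (g1 r)) ->
  (forall r, 0 < r -> has_der r s (s1 r)) ->
  cont_pos g1 -> cont_pos s1 -> (forall r, 0 < r -> 0 <= g r) ->
  half_integral (fun r => (g1 r * s r + g r * s1 r
      + 2 * q * coth r * g r * s r - g r * s r ^+ 2) * f r ^+ 2 * vol r)
  <= half_integral (fun r => g r * d1 r ^+ 2 * vol r).
Proof.
move=> dg ds cg1 cs1 g_ge0.
have cg := cont_pos_der dg; have cs := cont_pos_der ds.
apply: (half_integral_le a_gt0 a_le_b
  (G := fun r => g r * s r * f r ^+ 2 * vol r)
  (dG := fun r => (g1 r * s r + g r * s1 r + 2 * q * coth r * g r * s r)
    * f r ^+ 2 * vol r + 2 * (g r * s r * f r * d1 r * vol r))).
- by cont_pos_auto.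
- by move=> r hr; rewrite f0//; ring.
- by cont_pos_auto.
- by move=> r hr; rewrite d10//; ring.
- by move=> r r0; apply: der_eq; [der_auto|ring].
- by cont_pos_auto.
- by move=> r hr; rewrite f0//; ring.
- by move=> r hr; rewrite f0//; ring.
- move=> r r0; rewrite -subr_ge0; set lhs := (X in 0 <= X).
  have -> : lhs = g r * vol r * (d1 r + s r * f r) ^+ 2 by rewrite /lhs; ring.
  by rewrite mulr_ge0 ?sqr_ge0// mulr_ge0 ?g_ge0 ?vol_ge0.
Qed.

(** The completed square is [(d1 + s f)^2] with [s = q coth r - 1/(2 r)]; it
    vanishes for [f = r^(1/2) (sinh r)^(-q)].  What is left over is the potential
    [q (q - 1) / sinh^2 r >= 0]. *)
Lemma poincare_hardy_half_line :
  half_integral (fun r => (q ^+ 2 + 4^-1 * r^-1 ^+ 2) * f r ^+ 2 * vol r)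
  <= half_integral (fun r => d1 r ^+ 2 * vol r).
Proof.
have q3 := q_ge3.
apply: (half_integral_le a_gt0 a_le_b
  (G := fun r => (q * coth r + - (2^-1 * r^-1)) * f r ^+ 2 * vol r)
  (dG := fun r => (q * (1 - coth r ^+ 2) + 2^-1 * r^-1 ^+ 2
     + 2 * q * coth r * (q * coth r + - (2^-1 * r^-1))) * f r ^+ 2 * vol r
     + 2 * ((q * coth r + - (2^-1 * r^-1)) * f r * d1 r * vol r))).
- by cont_pos_auto.
- by move=> r hr; rewrite f0//; ring.
- by cont_pos_auto.
- by move=> r hr; rewrite d10//; ring.
- by move=> r r0; apply: der_eq; [der_auto|have r1 := lt0r_neq0 r0; field].
- by cont_pos_auto.
- by move=> r hr; rewrite f0//; ring.
- by move=> r hr; rewrite f0//; ring.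
- move=> r r0; rewrite -subr_ge0; set lhs := (X in 0 <= X).
  have -> : lhs = vol r * (d1 r + (q * coth r + - (2^-1 * r^-1)) * f r) ^+ 2
      + q * (q - 1) * (coth r ^+ 2 - 1) * f r ^+ 2 * vol r.
    by have r1 := lt0r_neq0 r0; rewrite /lhs; field.
  have c1 : 0 <= coth r ^+ 2 - 1.
    by rewrite subr_ge0 expr_ge1// ltW// ?coth_gt1// (lt_trans _ (coth_gt1 r0)).
  rewrite addr_ge0// mulr_ge0 ?sqr_ge0 ?vol_ge0//.
  by rewrite mulr_ge0 ?sqr_ge0// mulr_ge0// mulr_ge0; lra.
Qed.

(** The weighted Hardy inequality with [g = r^-2] and [s = (q - 3/2)/r + 1].  The
    coefficient of [1/r] in [s] is the optimal one near 0; the summand 1 produces,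
    through the second order lower bound of [coth], the term [q r^-2]. *)
Lemma hardy_gradient_half_line :
  half_integral (fun r => ((q - 3 / 2) ^+ 2 * r^-1 ^+ 4 + q * r^-1 ^+ 2)
    * f r ^+ 2 * vol r)
  <= half_integral (fun r => r^-1 ^+ 2 * d1 r ^+ 2 * vol r).
Proof.
have q3 := q_ge3; set A := q - 3 / 2.
have h := @weighted_hardy (fun r => r^-1 ^+ 2) (fun r => - 2 * r^-1 ^+ 3)
  (fun r => A * r^-1 + 1) (fun r => - (A * r^-1 ^+ 2)).
apply: le_trans (h _ _ _ _ _); last first.
- by move=> r r0; rewrite exprn_ge0// invr_ge0 ltW.
- by cont_pos_auto.
- by cont_pos_auto.
- by move=> r r0; apply: der_eq; [der_auto|ring].
- by move=> r r0; apply: der_eq (der_inv_exp 2 r0) _.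
apply: (half_integral_mono a_gt0 (b := b)).
- by cont_pos_auto.
- by move=> r hr; rewrite f0//; ring.
- by cont_pos_auto.
- by move=> r hr; rewrite f0//; ring.
- move=> r r0; rewrite ler_wpM2r ?vol_ge0// ler_wpM2r ?sqr_ge0//.
  have i0 : 0 < r^-1 by rewrite invr_gt0.
  have cge : r^-1 + (1 + 3 * r^-1)^-1 <= coth r.
    apply: le_trans (coth_ge r0); rewrite lerD2l le_eqVlt; apply/orP; left.
    by apply/eqP; field; rewrite !gt_eqF//; lra.
  move: cge; set i := r^-1 in i0 *; set c := coth r => cge.
  have p0 : 0 < 1 + 3 * i by lra.
  rewrite -subr_ge0; set lhs := (X in 0 <= X).
  (* After [c] is replaced by its lower bound, a quadratic polynomial in [i]
     remains; it is positive because [3 <= q]. *)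
  have -> : lhs = i ^+ 2 * ((2 * q * (A * i + 1)) * (c - (i + (1 + 3 * i)^-1)))
    + i ^+ 2 / (1 + 3 * i) * (3 * i ^+ 2 + (2 * q * A - 3 * q - 2) * i + (q - 1)).
    by rewrite /lhs /A; field; rewrite gt_eqF.
  have A0 : 0 <= A by rewrite /A; lra.
  rewrite addr_ge0//.
    rewrite mulr_ge0 ?sqr_ge0// mulr_ge0 ?subr_ge0//.
    by rewrite mulr_ge0 ?addr_ge0 ?mulr_ge0 ?(ltW i0)//; lra.
  apply: mulr_ge0; first by apply: divr_ge0; [exact: sqr_ge0|exact: ltW].
  have : -2 <= 2 * q * A - 3 * q - 2 by rewrite /A; nra.
  move: (2 * q * A - 3 * q - 2) => e he.
  by have := sqr_ge0 (i - 2 / 3); nra.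
Qed.

Section second_derivative.
Context (d2 : R -> R).
Hypotheses (dd1 : forall r, 0 < r -> has_der r d1 (d2 r)) (cd2 : cont_pos d2).
Hypothesis (d20 : vanish_off a b d2).

Local Notation lap := (fun r => d2 r + N.-1%:R * coth r * d1 r).

Let lapE r : lap r = d2 r + 2 * q * coth r * d1 r.
Proof. by rewrite dim_pred. Qed.

(** After integration by parts, completing the square in [d1 + s f] with
    [s = q coth r - (m + 1)/(2 r)] leaves the potential
    [q^2 + q (q - 1)/sinh^2 r + (1 - m^2)/(4 r^2)], and
    [1/sinh^2 r = coth^2 r - 1 >= r^-2 - 1] gives the stated form. *)
Lemma weighted_form_lower_bound (m : nat) :
  half_integral (fun r => r^-1 ^+ m
    * (q + ((q - 2^-1) ^+ 2 - m%:R ^+ 2 / 4) * r^-1 ^+ 2) * f r ^+ 2 * vol r)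
  <= half_integral (fun r => - (r^-1 ^+ m * f r * lap r * vol r)).
Proof.
have q3 := q_ge3; set M := m%:R : R.
pose s (r : R) := q * coth r + - ((M + 1) / 2 * r^-1).
have dm r : 0 < r -> has_der r (fun t => t^-1 ^+ m) (- M * (r^-1 * r^-1 ^+ m)).
  by move=> r0; apply: der_eq (der_inv_exp m r0) _; rewrite exprS.
have cm : cont_pos (fun r : R => r^-1 ^+ m) by cont_pos_auto.
have clap : cont_pos lap by cont_pos_auto.
have cs : cont_pos s by rewrite /s; cont_pos_auto.
have ds r : 0 < r -> has_der r s (q * (1 - coth r ^+ 2) + (M + 1) / 2 * r^-1 ^+ 2).
  by move=> r0; rewrite /s; apply: der_eq; [der_auto|have r1 := lt0r_neq0 r0; field].
apply: (half_integral_le a_gt0 a_le_b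
  (G := fun r => r^-1 ^+ m * (f r * d1 r + (s r + M / 2 * r^-1) * f r ^+ 2) * vol r)
  (dG := fun r => r^-1 ^+ m * (- (M * r^-1) * (f r * d1 r + (s r + M / 2 * r^-1) * f r ^+ 2)
    + (d1 r ^+ 2 + f r * d2 r
      + (q * (1 - coth r ^+ 2) + (M + 1) / 2 * r^-1 ^+ 2 - M / 2 * r^-1 ^+ 2) * f r ^+ 2
      + 2 * ((s r + M / 2 * r^-1) * f r * d1 r))
    + 2 * q * coth r * (f r * d1 r + (s r + M / 2 * r^-1) * f r ^+ 2)) * vol r)).
- by cont_pos_auto.
- by move=> r hr; rewrite f0//; ring.
- by cont_pos_auto.
- by move=> r hr; rewrite f0//; ring.
- by move=> r r0; apply: der_eq; [der_auto|have r1 := lt0r_neq0 r0; field].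
- by cont_pos_auto.
- by move=> r hr; rewrite f0//; ring.
- by move=> r hr; rewrite f0// d10//; ring.
- move=> r r0; rewrite lapE -subr_ge0; set lhs := (X in 0 <= X).
  have -> : lhs = r^-1 ^+ m * vol r * ((d1 r + s r * f r) ^+ 2
      + q * (q - 1) * (coth r ^+ 2 - r^-1 ^+ 2) * f r ^+ 2).
    by have r1 := lt0r_neq0 r0; rewrite /lhs /s; field.
  have i0 : 0 <= r^-1 by rewrite invr_ge0 ltW.
  rewrite mulr_ge0//; first by rewrite mulr_ge0 ?vol_ge0// exprn_ge0.
  rewrite addr_ge0 ?sqr_ge0// mulr_ge0 ?sqr_ge0// mulr_ge0//.
    by rewrite mulr_ge0//; lra.
  by rewrite subr_ge0 lerXn2r ?nnegrE ?coth_geV// (le_trans i0 (coth_geV r0)).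
Qed.

(** Expand [(lap f + G f)^2 >= 0] with [G = rellich_const j r^-2 + q].  The cross
    term consists of two forms [- r^-m f lap f], for [m = 2 j] and [m = 2 j + 2],
    and each is bounded below by [r^-m G f^2]; hence it contributes twice
    [r^(-2 j) G^2 f^2], of which one copy is lost to the last square. *)
Lemma weighted_rellich_half_line (j : nat) : 0 <= rellich_const R N j ->
  half_integral (fun r => r^-1 ^+ (2 * j)
    * (rellich_const R N j * r^-1 ^+ 2 + q) ^+ 2 * f r ^+ 2 * vol r)
  <= half_integral (fun r => r^-1 ^+ (2 * j) * lap r ^+ 2 * vol r).
Proof.
set C := rellich_const R N j => C0; have q3 := q_ge3.
have clap : cont_pos lap by cont_pos_auto.
have lap0 : vanish_off a b lap by move=> r hr; rewrite d20// d10//; ring.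
have cm m : cont_pos (fun r : R => r^-1 ^+ m) by cont_pos_auto.
have CE : (q - 2^-1) ^+ 2 - (2 * j).+2%:R ^+ 2 / 4 = C.
  rewrite /C /rellich_const (_ : (2 * j).+2%:R = 2 * j%:R + 2); first by field.
  by rewrite -natrM -natrD addn2.
pose G (r : R) := C * r^-1 ^+ 2 + q.
have cG : cont_pos G by rewrite /G; cont_pos_auto.
pose cross m (r : R) := - (r^-1 ^+ m * f r * lap r * vol r).
pose low m (r : R) := r^-1 ^+ m * G r * f r ^+ 2 * vol r.
have ccross m : cont_pos (cross m).
  by have := cm m => ?; rewrite /cross; cont_pos_auto.
have cross0 m : vanish_off a b (cross m).
  by move=> r hr; rewrite /cross f0//; ring.
have clow m : cont_pos (low m).
  by have := cm m => ?; rewrite /low; cont_pos_auto.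
have low0 m : vanish_off a b (low m).
  by move=> r hr; rewrite /low f0//; ring.
have low_cross2 : half_integral (low (2 * j).+2) <= half_integral (cross (2 * j).+2).
  have := weighted_form_lower_bound (2 * j).+2; rewrite CE; apply: le_trans.
  by rewrite /low /G le_eqVlt; apply/orP; left; apply/eqP; congr half_integral;
     apply/funext => r; rewrite [q + _]addrC.
have low_cross0 : half_integral (low (2 * j)) <= half_integral (cross (2 * j)).
  apply: le_trans (weighted_form_lower_bound (2 * j)).
  have := cm (2 * j)%N => ?; have := clow (2 * j)%N => ?.
  apply: (half_integral_mono a_gt0 (b := b)).
  - by cont_pos_auto.
  - by move=> r hr; rewrite low0.
  - by cont_pos_auto.
  - by move=> r hr; rewrite f0//; ring.
  move=> r r0; rewrite /low ler_wpM2r ?vol_ge0// ler_wpM2r ?sqr_ge0//.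
  have i0 : 0 <= r^-1 by rewrite invr_ge0 ltW.
  rewrite ler_wpM2l ?exprn_ge0// /G addrC lerD2l ler_wpM2r ?exprn_ge0//.
  rewrite -CE lerD2l lerN2 ler_wpM2r// ler_sqr ?nnegrE// ler_nat; lia.
have iS (r : R) : r^-1 ^+ (2 * j).+2 = r^-1 ^+ 2 * r^-1 ^+ (2 * j).
  by rewrite -exprD.
pose sq (r : R) := r^-1 ^+ (2 * j) * G r ^+ 2 * f r ^+ 2 * vol r.
have csq : cont_pos sq by have := cm (2 * j)%N => ?; rewrite /sq; cont_pos_auto.
have sq0 : vanish_off a b sq by move=> r hr; rewrite /sq f0//; ring.
rewrite -/sq; change (half_integral sq <=
  half_integral (fun r => r^-1 ^+ (2 * j) * lap r ^+ 2 * vol r)).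
have sqE : half_integral sq
    = C * half_integral (low (2 * j).+2) + q * half_integral (low (2 * j)).
  rewrite -(half_integral_lin (a := a) (b := b))//; congr half_integral.
  by apply/funext => r; rewrite /sq /low /G iS; ring.
pose crosses r := C * cross (2 * j).+2 r + q * cross (2 * j) r.
have crossE : half_integral crosses
    = C * half_integral (cross (2 * j).+2) + q * half_integral (cross (2 * j)).
  by rewrite (half_integral_lin (a := a) (b := b)).
have ccr : cont_pos crosses.
  by have := ccross (2 * j)%N; have := ccross (2 * j).+2 => ? ?; rewrite /crosses; cont_pos_auto.
have cr0 : vanish_off a b crosses.
  by move=> r hr; rewrite /crosses !cross0//; ring.
have sq_crosses : half_integral sq <= half_integral crosses.
  by rewrite sqE crossE lerD// ler_wpM2l//; lra.
have : half_integral (fun r => 2 * crosses r + (-1) * sq r)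
    <= half_integral (fun r => r^-1 ^+ (2 * j) * lap r ^+ 2 * vol r).
  have := cm (2 * j)%N => ?.
  apply: (half_integral_mono a_gt0 (b := b)).
  - by cont_pos_auto.
  - by move=> r hr; rewrite cr0// sq0//; ring.
  - by cont_pos_auto.
  - by move=> r hr; rewrite d10// d20//; ring.
  move=> r r0; rewrite -subr_ge0; set lhs := (X in 0 <= X).
  have -> : lhs = r^-1 ^+ (2 * j) * vol r * (lap r + G r * f r) ^+ 2.
    by rewrite /lhs /crosses /cross /sq /G iS; ring.
  by rewrite mulr_ge0 ?sqr_ge0// mulr_ge0 ?vol_ge0// exprn_ge0// invr_ge0 ltW.
by rewrite (half_integral_lin (a := a) (b := b))//; lra.
Qed.

End second_derivative.
End one_function.

(** Up to an exact derivative [(lap f)^2] is [f''^2 + 2 q (coth^2 r - 1) f'^2].  The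
    Poincare-Hardy inequality for [f'] bounds the first term, and the weighted
    Hardy inequality converts the resulting [f'^2 / (4 r^2)] into terms in [f]. *)
Lemma rellich_gradient_half_line (f d1 d2 : R -> R) :
  (forall r, 0 < r -> has_der r f (d1 r)) ->
  (forall r, 0 < r -> has_der r d1 (d2 r)) -> cont_pos d2 ->
  vanish_off a b f -> vanish_off a b d1 -> vanish_off a b d2 ->
  q ^+ 2 * half_integral (fun r => d1 r ^+ 2 * vol r)
  + half_integral (fun r => ((n_ - 4) ^+ 2 / 16 * r^-1 ^+ 4
                             + (n_ - 1) / 8 * r^-1 ^+ 2) * f r ^+ 2 * vol r)
  <= half_integral (fun r => (d2 r + N.-1%:R * coth r * d1 r) ^+ 2 * vol r).
Proof.
move=> df dd1 cd2 f0 d10 d20; have q3 := q_ge3.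
have cd1 := cont_pos_der dd1; have cf := cont_pos_der df.
pose A r := d1 r ^+ 2 * vol r.
pose B r := r^-1 ^+ 2 * d1 r ^+ 2 * vol r.
pose E r := ((q - 3 / 2) ^+ 2 * r^-1 ^+ 4 + q * r^-1 ^+ 2) * f r ^+ 2 * vol r.
have cA : cont_pos A by rewrite /A; cont_pos_auto.
have cB : cont_pos B by rewrite /B; cont_pos_auto.
have cE : cont_pos E by rewrite /E; cont_pos_auto.
have A0 : vanish_off a b A by move=> r hr; rewrite /A d10//; ring.
have B0 : vanish_off a b B by move=> r hr; rewrite /B d10//; ring.
have E0 : vanish_off a b E by move=> r hr; rewrite /E f0//; ring.
have BE : half_integral E <= half_integral B.
  exact: hardy_gradient_half_line df cd1 f0 d10.
have P : q ^+ 2 * half_integral A + 4^-1 * half_integral B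
    <= half_integral (fun r => d2 r ^+ 2 * vol r).
  rewrite -(half_integral_lin (a := a) (b := b))//.
  apply: le_trans (poincare_hardy_half_line dd1 cd2 d10 d20).
  rewrite le_eqVlt; apply/orP; left; apply/eqP; congr half_integral.
  by apply/funext => r; rewrite /A /B; ring.
have EE : half_integral (fun r => ((n_ - 4) ^+ 2 / 16 * r^-1 ^+ 4
    + (n_ - 1) / 8 * r^-1 ^+ 2) * f r ^+ 2 * vol r) = 4^-1 * half_integral E.
  rewrite -(half_integralZ a_gt0 _ cE E0); congr half_integral.
  by apply/funext => r; rewrite /E; move: (r^-1) => i; field.
rewrite EE; apply: le_trans (_ : _ <= half_integral (fun r => d2 r ^+ 2 * vol r)) _.
  by apply: le_trans P; rewrite lerD2l ler_wpM2l.
apply: (half_integral_le a_gt0 a_le_b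
  (G := fun r => - (2 * q * coth r * d1 r ^+ 2 * vol r))
  (dG := fun r => - (2 * q) * ((1 - coth r ^+ 2) * d1 r ^+ 2
    + 2 * (coth r * d1 r * d2 r) + 2 * q * coth r ^+ 2 * d1 r ^+ 2) * vol r)).
- by cont_pos_auto.
- by move=> r hr; rewrite d20//; ring.
- by cont_pos_auto.
- by move=> r hr; rewrite d10// d20//; ring.
- by move=> r r0; apply: der_eq; [der_auto|ring].
- by cont_pos_auto.
- by move=> r hr; rewrite d10//; ring.
- by move=> r hr; rewrite d10//; ring.
- move=> r r0; rewrite dim_pred -subr_ge0; set lhs := (X in 0 <= X).
  have -> : lhs = 2 * q * (coth r ^+ 2 - 1) * d1 r ^+ 2 * vol r.
    by rewrite /lhs; ring.
  have c1 : 0 <= coth r ^+ 2 - 1.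
    by rewrite subr_ge0 expr_ge1// ltW// ?coth_gt1// (lt_trans _ (coth_gt1 r0)).
  by rewrite mulr_ge0 ?vol_ge0// mulr_ge0 ?sqr_ge0// mulr_ge0//; lra.
Qed.
End half_line_inequalities.

(** * Families of functions on the half-line indexed by directions *)

Section near_rules.
Context (R : realType).
Implicit Types f g : R -> R.

Lemma der_near x f g v : (\forall t \near x, f t = g t) ->
  has_der x f v -> has_der x g v.
Proof. exact: near_eq_is_derive. Qed.

Lemma derive1_der x f v : has_der x f v -> derive1 f x = v.
Proof. by move=> [_ fv]; rewrite derive1E. Qed.

Lemma derive1_near x f g : (\forall t \near x, f t = g t) ->
  derive1 f x = derive1 g x.
Proof. by move=> fg; rewrite !derive1E; exact: near_eq_derive. Qed.

Lemma continuous_near x f g : (\forall t \near x, f t = g t) ->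
  {for x, continuous f} -> {for x, continuous g}.
Proof.
move=> fg cf; rewrite /prop_for /continuous_at -(nbhs_singleton fg).
exact: cvg_trans (near_eq_cvg fg) cf.
Qed.

End near_rules.

Section regular_families.
Context (R : realType) (d : measure_display) (T : measurableType d) (S : set T).
Context (a b : R).
Hypotheses (a_gt0 : 0 < a) (a_le_b : a <= b).
Implicit Types phi psi : T -> R -> R.

(** One function on the half-line for each direction in [S]; the bound and the
    support are uniform in the direction, so that integrals over the half-line
    are bounded functions of the direction. *)
Definition bounded_family phi :=
  [/\ forall s, S s -> vanish_off a b (phi s),
      forall s, S s -> forall r, {for r, continuous (phi s)},
      exists M, forall s, S s -> forall r, `|phi s r| <= M
    & measurable_fun (S `*` [set: measurableTypeR R]) (fun p => phi p.1 p.2)].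

Fixpoint regular_family n phi : Prop :=
  bounded_family phi /\
  match n with
  | 0 => True
  | n'.+1 =>
      (forall s, S s -> forall r, has_der r (phi s) (derive1 (phi s) r)) /\
      regular_family n' (fun s => derive1 (phi s))
  end.

Definition smooth_family phi := forall n, regular_family n phi.

Lemma regular_family_bounded n phi : regular_family n phi -> bounded_family phi.
Proof. by case: n => [|n] []. Qed.

Lemma bounded_family_eq phi psi : (forall s, S s -> phi s = psi s) ->
  bounded_family phi -> bounded_family psi.
Proof.
move=> pp [v c [M bd] m]; split.
- by move=> s Ss; rewrite -pp//; exact: v.
- by move=> s Ss; rewrite -pp//; exact: c.
- by exists M => s Ss; rewrite -pp//; exact: bd.
- apply: eq_measurable_fun m => -[s r]; rewrite inE => -[/= Ss _].
  by rewrite pp.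
Qed.

Lemma regular_family_eq n phi psi : (forall s, S s -> phi s = psi s) ->
  regular_family n phi -> regular_family n psi.
Proof.
elim: n phi psi => [|n IH] phi psi pp [bp].
  by move=> _; split => //; exact: bounded_family_eq bp.
move=> [dp rp]; split; first exact: bounded_family_eq bp.
split; first by move=> s Ss; rewrite -pp//; exact: dp.
by apply: IH rp => s Ss; rewrite pp.
Qed.

Lemma regular_familyW n phi : regular_family n.+1 phi -> regular_family n phi.
Proof.
elim: n phi => [|n IH] phi [bp [dp rp]]; first by split.
by split => //; split => //; exact: IH.
Qed.

Lemma bounded_family_add phi psi : bounded_family phi -> bounded_family psi ->
  bounded_family (fun s r => phi s r + psi s r).
Proof.
move=> [v c [M bd] m] [v' c' [M' bd'] m']; split.
- by move=> s Ss r hr; rewrite v// v'// addr0.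
- by move=> s Ss r; apply: cvgD; [exact: c|exact: c'].
- exists (M + M') => s Ss r; apply: le_trans (ler_normD _ _) _.
  by rewrite lerD ?bd ?bd'.
- exact: measurable_funD.
Qed.

Lemma bounded_family_prod phi psi : bounded_family phi -> bounded_family psi ->
  bounded_family (fun s r => phi s r * psi s r).
Proof.
move=> [v c [M bd] m] [v' c' [M' bd'] m']; split.
- by move=> s Ss r hr; rewrite v// mul0r.
- by move=> s Ss r; apply: cvgM; [exact: c|exact: c'].
- by exists (M * M') => s Ss r; rewrite normrM ler_pM ?normr_ge0 ?bd ?bd'.
- exact: measurable_funM.
Qed.

Lemma bounded_family_scale (c : T -> R) phi : measurable_fun [set: T] c ->
  (exists M, forall s, S s -> `|c s| <= M) -> bounded_family phi ->
  bounded_family (fun s r => c s * phi s r).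
Proof.
move=> mc [K cK] [v ct [M bd] m]; split.
- by move=> s Ss r hr; rewrite v// mulr0.
- by move=> s Ss r; apply: cvgM; [exact: cvg_cst|exact: ct].
- exists (K * M) => s Ss r; rewrite normrM ler_pM ?normr_ge0 ?cK ?bd//.
- apply: measurable_funM m; apply: (@measurableT_comp _ _ _ _ _ _ c) => //.
  exact: measurable_funS measurable_fst.
Qed.

Lemma bounded_family_mul rho phi : cont_pos rho -> bounded_family phi ->
  bounded_family (fun s r => rho r * phi s r).
Proof.
move=> crho [v c [M bd] m]; split.
- by move=> s Ss r hr; rewrite v// mulr0.
- move=> s Ss r; have [r0|r0] := ltP 0 r.
    by apply: cvgM; [exact: crho|exact: c].
  apply: (@continuous_near _ _ (fun=> 0)); last exact: cvg_cst.
  near=> t; rewrite v ?mulr0// negb_and -!ltNge; apply/orP; left.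
  by near: t; apply: lt_nbhsl; exact: le_lt_trans a_gt0.
- have [|K _ hK] := @EVT_max _ (fun r => `|rho r|) _ _ a_le_b.
    apply: continuous_in_subspaceT => r; rewrite inE/= in_itv/= => /andP[ar _].
    apply: (@continuous_comp _ _ _ rho); last exact: norm_continuous.
    by apply: crho; exact: lt_le_trans ar.
  exists (`|rho K| * `|M|) => s Ss r; rewrite normrM.
  have [rab|rab] := boolP (a <= r <= b).
    rewrite ler_pM//; first by apply: hK; rewrite in_itv.
    by apply: le_trans (bd _ Ss r) (ler_norm _).
  by rewrite v// normr0 mulr0 mulr_ge0.
- pose rho' : measurableTypeR R -> R := rho \_ `]0, +oo[.
  have mrho' : measurable_fun [set: measurableTypeR R] rho'.
    apply: (measurable_restrictT _ _).1 => //; apply: open_continuous_measurable_fun.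
      exact: interval_open.
    by move=> r; rewrite inE/= in_itv/= andbT => r0; exact: crho.
  apply: (@eq_measurable_fun _ _ _ _ _ (fun p => rho' p.2 * phi p.1 p.2)).
    move=> [s r]; rewrite inE => -[/= Ss _]; rewrite /rho' patchE.
    case: ifPn => //; rewrite notin_setE/= in_itv/= andbT => /negP; rewrite -leNgt => r0.
    by rewrite v ?mulr0// negb_and -!ltNge (le_lt_trans r0).
  apply: measurable_funM m; apply: (@measurableT_comp _ _ _ _ _ _ rho') => //.
  exact: measurable_funS measurable_snd.
Unshelve. all: by end_near. Qed.

Lemma regular_family_add n phi psi : regular_family n phi -> regular_family n psi ->
  regular_family n (fun s r => phi s r + psi s r).
Proof.
elim: n phi psi => [|n IH] phi psi [bp]; first by move=> _ [bp' _]; split; [exact: bounded_family_add|].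
move=> [dp rp] [bp' [dp' rp']].
have D s r : S s -> has_der r (fun r => phi s r + psi s r)
    (derive1 (phi s) r + derive1 (psi s) r).
  by move=> Ss; apply: der_add; [exact: dp|exact: dp'].
split; first exact: bounded_family_add.
split; first by move=> s Ss r; rewrite (derive1_der (D s r Ss)); exact: D.
apply: regular_family_eq (IH _ _ rp rp') => s Ss.
by apply/funext => r; rewrite (derive1_der (D s r Ss)).
Qed.

Lemma regular_family_scale n (c : T -> R) phi : measurable_fun [set: T] c ->
  (exists M, forall s, S s -> `|c s| <= M) -> regular_family n phi ->
  regular_family n (fun s r => c s * phi s r).
Proof.
move=> mc cM; elim: n phi => [|n IH] phi [bp].
  by move=> _; split; [exact: bounded_family_scale|].
move=> [dp rp].
have D s r : S s -> has_der r (fun r => c s * phi s r) (c s * derive1 (phi s) r).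
  move=> Ss; apply: der_eq; first by apply: der_mul; [exact: der_cst|exact: dp].
  by cbv beta; ring.
split; first exact: bounded_family_scale.
split; first by move=> s Ss r; rewrite (derive1_der (D s r Ss)); exact: D.
apply: regular_family_eq (IH _ rp) => s Ss.
by apply/funext => r; rewrite (derive1_der (D s r Ss)).
Qed.

Lemma bounded_family0 : bounded_family (fun _ _ => 0).
Proof.
split => //.
- by move=> s _ r; exact: cvg_cst.
- by exists 0 => s _ r; rewrite normr0.
Qed.

Lemma regular_family0 n : regular_family n (fun _ _ => 0).
Proof.
elim: n => [|n IH]; first by split => //; exact: bounded_family0.
have D r : has_der r (fun=> 0 : R) 0 by exact: der_cst.
split; first exact: bounded_family0.
split; first by move=> s Ss r; rewrite (derive1_der (D r)).
by apply: regular_family_eq IH => s Ss; apply/funext => r; rewrite (derive1_der (D r)).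
Qed.

Lemma regular_family_sum n (I : Type) (s : seq I) (F : I -> T -> R -> R) :
  (forall i, regular_family n (F i)) ->
  regular_family n (fun t r => \sum_(i <- s) F i t r).
Proof.
move=> rF; elim: s => [|i s IH].
  apply: regular_family_eq (regular_family0 n) => t _.
  by apply/funext => r; rewrite big_nil.
apply: regular_family_eq (regular_family_add (rF i) IH) => t _.
by apply/funext => r; rewrite big_cons.
Qed.

(** Since [coth' = 1 - coth^2], the derivative of [coth phi] is again a
    combination of families of the form [coth psi], and induction applies. *)
Lemma regular_family_coth n phi : regular_family n phi ->
  regular_family n (fun s r => coth r * phi s r).
Proof.
have ccoth : cont_pos (@coth R) by exact: cont_pos_der (@der_coth R).
elim: n phi => [|n IH] phi rphi.
  by case: rphi => bp _; split; [exact: bounded_family_mul|].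
have rphi' := regular_familyW rphi.
case: rphi => bp [dp rp].
have [v _ _ _] := bp; have [v' _ _ _] := regular_family_bounded rp.
have D s r : S s -> has_der r (fun r => coth r * phi s r)
    (phi s r + (coth r * derive1 (phi s) r + -1 * (coth r * (coth r * phi s r)))).
  move=> Ss; have [r0|r0] := ltP 0 r.
    apply: der_eq; first by apply: der_mul; [exact: der_coth|exact: dp].
    by cbv beta; ring.
  have ra : r < a by exact: le_lt_trans a_gt0.
  apply: (@der_near _ _ (fun=> 0)).
    near=> t; rewrite v ?mulr0// negb_and -!ltNge; apply/orP; left.
    by near: t; exact: lt_nbhsl.
  apply: der_eq (der_cst r 0) _.
  by rewrite v// ?v'// ?mulr0 ?addr0// negb_and -!ltNge ra.
split; first exact: bounded_family_mul.
split; first by move=> s Ss r; rewrite (derive1_der (D s r Ss)); exact: D.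
have m1 : measurable_fun [set: T] (fun=> -1 : R) by exact: measurable_cst.
have b1 : exists M : R, forall s, S s -> `|(-1 : R)| <= M by exists `|-1|.
have := regular_family_add rphi'
  (regular_family_add (IH _ rp) (regular_family_scale m1 b1 (IH _ (IH _ rphi')))).
apply: regular_family_eq => s Ss.
by apply/funext => r; rewrite (derive1_der (D s r Ss)).
Unshelve. all: by end_near. Qed.

Definition radial_laplacian1 (N : nat) (f : R -> R) (r : R) : R :=
  derive1 (derive1 f) r + N.-1%:R * coth r * derive1 f r.

Lemma smooth_family_derive phi : smooth_family phi ->
  smooth_family (fun s => derive1 (phi s)).
Proof. by move=> sp n; have [_ []] := sp n.+1. Qed.

Lemma smooth_family_laplacian N phi : smooth_family phi ->
  smooth_family (fun s => radial_laplacian1 N (phi s)).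
Proof.
move=> sp n; rewrite /radial_laplacian1.
have sp1 := smooth_family_derive sp; have sp2 := smooth_family_derive sp1.
have m1 : measurable_fun [set: T] (fun=> N.-1%:R : R) by exact: measurable_cst.
have b1 : exists M : R, forall s, S s -> `|(N.-1%:R : R)| <= M by exists `|N.-1%:R|.
have := regular_family_add (sp2 n)
  (regular_family_scale m1 b1 (regular_family_coth (sp1 n))).
by apply: regular_family_eq => s Ss; apply/funext => r; rewrite mulrA.
Qed.

End regular_families.

Section profiles.
Context (R : realType) (N : nat) (d : measure_display) (T : measurableType d).
Context (S : set T).
Hypothesis N_ge7 : (7 <= N)%N.
Local Notation n_ := (N%:R : R).
Local Notation q := ((n_ - 1) / 2).
Local Notation vol := (@vol R N).

(** A profile is a member of a smooth family, rather than a smooth function, so that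
    closure under the radial Laplacian is inherited from families. *)
Definition profile (f : R -> R) :=
  exists a b phi s, [/\ 0 < a, a <= b, smooth_family S a b phi, S s & f = phi s].

Definition hardy_integral (j : nat) (f : R -> R) : R :=
  half_integral (fun r => f r ^+ 2 * r^-1 ^+ (2 * j) * vol r).

Definition gradient_integral (f : R -> R) : R :=
  half_integral (fun r => derive1 f r ^+ 2 * vol r).

Lemma profile_laplacian f : profile f -> profile (radial_laplacian1 N f).
Proof.
move=> [a [b [phi [s [a0 ab sphi Ss ->]]]]].
exists a, b, (fun s => radial_laplacian1 N (phi s)), s; split => //.
exact: smooth_family_laplacian.
Qed.

Lemma profileP f : profile f -> exists a b, [/\ 0 < a, a <= b,
  (forall r, 0 < r -> has_der r f (derive1 f r)) /\
  (forall r, 0 < r -> has_der r (derive1 f) (derive1 (derive1 f) r)),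
  cont_pos (derive1 (derive1 f)) &
  [/\ vanish_off a b f, vanish_off a b (derive1 f)
    & vanish_off a b (derive1 (derive1 f))]].
Proof.
move=> [a [b [phi [s [a0 ab sphi Ss ->]]]]]; exists a, b.
have [[v0 _ _ _] [d1 [[v1 _ _ _] [d2 [[v2 c2 _ _] _]]]]] := sphi 2%N.
have {}v0 := v0 s Ss; have {}v1 := v1 s Ss; have {}v2 := v2 s Ss.
split => //; first by split => r _; [exact: d1|exact: d2].
by move=> r _; exact: c2.
Qed.

Let cvol : cont_pos vol.
Proof. exact: cont_pos_der (der_vol N_ge7). Qed.

Let cinv : cont_pos (fun r : R => r^-1).
Proof.
move=> r r0; have r1 : (fun t : R => t) r != 0 by rewrite gt_eqF.
exact: der_continuous (der_inv r1 (der_id r)).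
Qed.

Let hardy_integrand_cont f m : cont_pos f ->
  cont_pos (fun r => f r ^+ 2 * r^-1 ^+ m * vol r).
Proof. by move=> cf; cont_pos_auto. Qed.

Let hardy_integrand_vanish a b f m : vanish_off a b f ->
  vanish_off a b (fun r => f r ^+ 2 * r^-1 ^+ m * vol r).
Proof. by move=> f0 r hr; rewrite f0// expr0n !mul0r. Qed.

Lemma profile_poincare_hardy f : profile f ->
  q ^+ 2 * hardy_integral 0 f + 4^-1 * hardy_integral 1 f <= gradient_integral f.
Proof.
move=> /profileP[a [b [a0 ab [d1 d2] c2 [v0 v1 v2]]]].
have c1 := cont_pos_der d2; have c0 := cont_pos_der d1.
rewrite /hardy_integral -(half_integral_lin a0 (b := b));
  [|exact: hardy_integrand_cont|exact: hardy_integrand_vanish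
   |exact: hardy_integrand_cont|exact: hardy_integrand_vanish].
apply: le_trans (poincare_hardy_half_line a0 ab N_ge7 d1 c1 v0 v1).
rewrite le_eqVlt; apply/orP; left; apply/eqP; congr half_integral.
by apply/funext => r; rewrite muln0 expr0 muln1; ring.
Qed.

Lemma profile_rellich_gradient f : profile f ->
  q ^+ 2 * gradient_integral f + (n_ - 4) ^+ 2 / 16 * hardy_integral 2 f
    + (n_ - 1) / 8 * hardy_integral 1 f
  <= hardy_integral 0 (radial_laplacian1 N f).
Proof.
move=> /profileP[a [b [a0 ab [d1 d2] c2 [v0 v1 v2]]]].
have c1 := cont_pos_der d2; have c0 := cont_pos_der d1.
rewrite -addrA /hardy_integral -(half_integral_lin a0 (b := b));
  [|exact: hardy_integrand_cont|exact: hardy_integrand_vanish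
   |exact: hardy_integrand_cont|exact: hardy_integrand_vanish].
have := rellich_gradient_half_line a0 ab N_ge7 d1 d2 c2 v0 v1 v2.
rewrite -/(gradient_integral f) => h.
apply: le_trans (le_trans _ h) _.
- rewrite lerD2l le_eqVlt; apply/orP; left; apply/eqP; congr half_integral.
  by apply/funext => r; rewrite muln1; ring.
- rewrite le_eqVlt; apply/orP; left; apply/eqP; congr half_integral.
  by apply/funext => r; rewrite muln0 expr0 mulr1.
Qed.

Lemma profile_weighted_rellich j f : 0 <= rellich_const R N j -> profile f ->
  rellich_const R N j ^+ 2 * hardy_integral j.+2 f
    + 2 * q * rellich_const R N j * hardy_integral j.+1 f
    + q ^+ 2 * hardy_integral j f
  <= hardy_integral j (radial_laplacian1 N f).
Proof.
move=> C0 /profileP[a [b [a0 ab [d1 d2] c2 [v0 v1 v2]]]].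
have c1 := cont_pos_der d2; have c0 := cont_pos_der d1.
have := weighted_rellich_half_line a0 ab N_ge7 d1 c1 v0 v1 d2 c2 v2 C0.
set C := rellich_const R N j => h.
pose F i (r : R) := f r ^+ 2 * r^-1 ^+ (2 * i) * vol r.
have cF i : cont_pos (F i) by exact: hardy_integrand_cont.
have vF i : vanish_off a b (F i) by exact: hardy_integrand_vanish.
pose G (r : R) := C ^+ 2 * F j.+2 r + 2 * q * C * F j.+1 r.
have cF2 := cF j.+2; have cF1 := cF j.+1.
have cG : cont_pos G by rewrite /G; cont_pos_auto.
have vG : vanish_off a b G by move=> r hr; rewrite /G !vF// !mulr0 addr0.
rewrite -(half_integral_lin a0 (b := b) (C ^+ 2) (2 * q * C) (cF j.+2) (vF j.+2)
  (cF j.+1) (vF j.+1)).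
rewrite -[half_integral _]mul1r.
rewrite -(half_integral_lin a0 (b := b) 1 (q ^+ 2) cG vG (cF j) (vF j)).
apply: le_trans (le_trans _ h) _.
- rewrite le_eqVlt; apply/orP; left; apply/eqP; congr half_integral.
  apply/funext => r; rewrite /G /F.
  have -> : (2 * j.+2 = 4 + 2 * j)%N by lia.
  have -> : (2 * j.+1 = 2 + 2 * j)%N by lia.
  by rewrite !exprD; ring.
- rewrite le_eqVlt; apply/orP; left; apply/eqP; congr half_integral.
  by apply/funext => r; congr (_ * _); exact: mulrC.
Qed.

Lemma profile_hardy_bound k l : (0 < l < k)%N -> (4 * k - 1 <= N)%N ->
  hardy_bound profile hardy_integral
    (fun f => energy1 (radial_laplacian1 N) hardy_integral gradient_integral k f
      - q ^+ (2 * (k - l))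
        * energy1 (radial_laplacian1 N) hardy_integral gradient_integral l f)
    1 k (D_one R N k l) (D_top R N k l).
Proof.
move=> lk kN; apply: (@hardy_bound_energy _ _ k) => //; first by lia.
- exact: profile_laplacian.
- exact: profile_poincare_hardy.
- exact: profile_rellich_gradient.
- move=> j f Pf jk; apply: profile_weighted_rellich => //.
  by apply/ltW/(@rellich_const_gt0 _ _ k) => //; lia.
Qed.

End profiles.

(** * Directional derivatives *)

Section line_derivatives.
Context (R : realType) (V : normedModType R).
Implicit Types (u g : V -> R) (x v w : V).

(** The derivative is attached to lines instead of points: scaling the direction
    then is the chain rule, and the mean value theorem applies along the line. *)
Definition has_line_der u v g :=
  forall x t, has_der t (fun t => u (x + t *: v)) (g (x + t *: v)).

Lemma der_cvg (f : R -> R) t l :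
  (k^-1 * (f (k + t) - f t) @[k --> 0^'] --> l) -> has_der t f l.
Proof.
have -> : (fun k : R => k^-1 * (f (k + t) - f t)) =
    (fun k : R => k^-1 *: ((f \o shift t) (k *: 1) - f t)).
  by apply/funext => k /=; rewrite scaler1.
by move=> fl; split; [apply/cvg_ex; exists l|exact: cvg_lim].
Qed.

Lemma cvg_der (f : R -> R) t l : has_der t f l ->
  k^-1 * (f (k + t) - f t) @[k --> 0^'] --> l.
Proof.
have -> : (fun k : R => k^-1 * (f (k + t) - f t)) =
    (fun k : R => k^-1 *: ((f \o shift t) (k *: 1) - f t)).
  by apply/funext => k /=; rewrite scaler1.
by move=> [df <-]; exact: df.
Qed.

Lemma has_line_der_derive u v : (forall x, derivable u x v) ->
  has_line_der u v ('D_v u).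
Proof.
move=> du x t.
have e : (fun k : R => k^-1 *: (((fun t => u (x + t *: v)) \o shift t) (k *: 1)
      - u (x + t *: v))) =
    (fun k : R => k^-1 *: ((u \o shift (x + t *: v)) (k *: v) - u (x + t *: v))).
  apply/funext => k /=; congr (_ *: (u _ - _)).
  by rewrite scaler1 scalerDl addrCA.
by split; [rewrite /derivable e; exact: du|rewrite /derive e].
Qed.

Lemma mean_value_step (f df : R -> R) : (forall t, has_der t f (df t)) ->
  forall k, exists2 c, `|c| <= `|k| & f k - f 0 = df c * k.
Proof.
move=> fdf k; have cf : continuous f by move=> t; exact: der_continuous (fdf t).
have [k0|k0] := leP 0 k.
  have [c] := MVT_segment k0 (fun t _ => fdf t) (continuous_subspaceT cf).
  rewrite in_itv/= subr0 => /andP[c0 ck] ->; exists c => //.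
  by rewrite !ger0_norm.
have [c] := MVT_segment (ltW k0) (fun t _ => fdf t) (continuous_subspaceT cf).
rewrite in_itv/= => /andP[c0 ck] e; exists c.
  by rewrite ler0_norm// ltr0_norm// lerN2.
by rewrite -opprB e sub0r mulrN opprK.
Qed.

(** The increment along [k (v + w)] is split at [y + k v]; on the second piece the
    mean value theorem and the continuity of [gw] make the difference quotient
    tend to [gw y]. *)
Lemma has_line_der_add u v w gv gw : has_line_der u v gv ->
  has_line_der u w gw -> continuous gw ->
  has_line_der u (v + w) (fun x => gv x + gw x).
Proof.
move=> dv dw cw x t; apply: der_cvg; set y := x + t *: (v + w).
have dvy := cvg_der (dv y 0).
rewrite scale0r addr0 in dvy.
apply/cvgrPdist_lt => e e0.
have e2 : 0 < e / 2 by rewrite divr_gt0.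
have /cvgrPdist_lt /(_ _ e2) /nbhs_ballP[r /= r0 hr] := cw y.
pose M := `|v| + `|w| + 1.
have M0 : 0 < M by rewrite /M ltr_wpDl// addr_ge0.
near=> k.
have k0 : k != 0 by near: k; exact: nbhs_dnbhs_neq.
have -> : x + (k + t) *: (v + w) = (y + k *: v) + k *: w.
  rewrite /y scalerDl [k *: (v + w)]scalerDr.
  by rewrite [k *: v + k *: w + _]addrC !addrA.
have [c ck] := mean_value_step (dw (y + k *: v)) k.
rewrite scale0r addr0 => hc.
have hv : `|gv y - k^-1 * (u (y + k *: v) - u y)| < e / 2.
  near: k; move/cvgrPdist_lt : dvy => /(_ _ e2).
  by apply: filterS => k; rewrite addr0.
have hw : `|gw y - gw (y + k *: v + c *: w)| < e / 2.
  apply: hr; rewrite -ball_normE /=.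
  have -> : y - (y + k *: v + c *: w) = - (k *: v + c *: w).
    by rewrite -(addrA y) opprD addrA addrN add0r.
  rewrite normrN; apply: le_lt_trans (ler_normD _ _) _.
  rewrite !normrZ; apply: (@le_lt_trans _ _ (`|k| * M)).
    rewrite /M !mulrDr mulr1 -addrA lerD2l; apply: le_trans (_ : _ <= `|k| * `|w|) _.
      by rewrite ler_wpM2r.
    by rewrite lerDl.
  rewrite -ltr_pdivlMr//; near: k; apply: dnbhs0_lt; exact: divr_gt0.
have -> : gv y + gw y - k^-1 * (u (y + k *: v + k *: w) - u y) =
   (gv y - k^-1 * (u (y + k *: v) - u y)) + (gw y - gw (y + k *: v + c *: w)).
  have -> : u (y + k *: v + k *: w) =
      u (y + k *: v) + gw (y + k *: v + c *: w) * k by rewrite -hc; ring.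
  by field.
by rewrite [ltRHS]splitr; apply: le_lt_trans (ler_normD _ _) _; rewrite ltrD.
Unshelve. all: by end_near. Qed.

Lemma has_line_der_scale u v g c : has_line_der u v g ->
  has_line_der u (c *: v) (fun x => c * g x).
Proof.
move=> dv x t; rewrite /has_der.
have -> : (fun t => u (x + t *: (c *: v))) = (fun t => u (x + t *: v)) \o (fun t => t * c).
  by apply/funext => s /=; rewrite scalerA.
rewrite scalerA mulrC; apply: is_derive1_comp; first exact: dv.
apply: (@der_eq _ _ (fun t => t * c)); first by apply: der_mul; [exact: der_id|exact: der_cst].
by rewrite /=; ring.
Qed.

Lemma has_line_der0 u : has_line_der u 0 (fun=> 0).
Proof.
move=> x t; rewrite (_ : (fun t => _) = fun=> u x); first exact: der_cst.
by apply/funext => s; rewrite scaler0 addr0.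
Qed.

(** For the coordinate directions: continuous partial derivatives give all
    directional derivatives. *)
Lemma has_line_der_sum u (I : Type) (s : seq I) (c : I -> R) (v : I -> V)
    (g : I -> V -> R) :
  (forall i, has_line_der u (v i) (g i)) -> (forall i, continuous (g i)) ->
  has_line_der u (\sum_(i <- s) c i *: v i) (fun x => \sum_(i <- s) c i * g i x).
Proof.
move=> dg cg.
suff [] : has_line_der u (\sum_(i <- s) c i *: v i)
    (fun x => \sum_(i <- s) c i * g i x) /\
    continuous (fun x => \sum_(i <- s) c i * g i x) by [].
elim: s => [|i s [IH cIH]].
  rewrite big_nil (_ : (fun x => _) = fun=> 0); last first.
    by apply/funext => x; rewrite big_nil.
  by split; [exact: has_line_der0|move=> x; exact: cvg_cst].
have -> : (fun x => \sum_(j <- i :: s) c j * g j x) =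
    (fun x => c i * g i x + \sum_(j <- s) c j * g j x).
  by apply/funext => x; rewrite big_cons.
rewrite big_cons; split.
  by apply: has_line_der_add => //; exact: has_line_der_scale.
by move=> x; apply: cvgD; [apply: cvgM; [exact: cvg_cst|exact: cg]|exact: cIH].
Qed.

End line_derivatives.

(** * Smooth functions in polar coordinates *)

Section row_vectors.
Context (R : realType) (N : nat).
Notation HN := 'rV[R]_N.
Notation dirs := (N.-tuple (measurableTypeR R)).

Lemma norm_row_le (x : HN) (c : R) : 0 <= c -> (forall i, `|x ord0 i| <= c) ->
  `|x| <= c.
Proof.
move=> c0 xc; change (mx_norm x <= c); rewrite mx_normrE.
by apply: bigmax_le => // -[i j] _ /=; rewrite ord1.
Qed.

Lemma norm_coord_le (x : HN) i : `|x ord0 i| <= `|x|.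
Proof.
change (`|x ord0 i| <= mx_norm x); rewrite mx_normrE.
exact: (le_bigmax _ (fun ij : 'I_1 * 'I_N => `|x ij.1 ij.2|) (ord0, i)).
Qed.

Lemma measurable_countable_valued d (T : measurableType d) (C : countType)
    (z : T -> C) (g : C -> R) :
  (forall c, measurable (z @^-1` [set c])) -> measurable_fun [set: T] (g \o z).
Proof.
move=> mz _ Y mY; rewrite setTI.
have -> : (g \o z) @^-1` Y = \bigcup_(n : nat)
    (if @unpickle C n is Some c then
       if `[< Y (g c) >] then z @^-1` [set c] else set0 else set0).
  apply/seteqP; split => [t /= Yt|t [n _]] /=.
    by exists (pickle (z t)) => //; rewrite pickleK; case: asboolP.
  by case: unpickle => // c; case: asboolP => // Yc /= zt; rewrite zt.
apply: bigcupT_measurable => n; case: unpickle => [c|] //.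
by case: asboolP.
Qed.

Lemma measurable_coord (i : 'I_N) :
  measurable_fun [set: dirs * measurableTypeR R] (fun p => p.2 * tnth p.1 i).
Proof.
apply: measurable_funM; first exact: measurable_snd.
by apply: (measurableT_comp (measurable_tnth i)); exact: measurable_fst.
Qed.

(** A continuous function of [r sigma] is the pointwise limit of its values at
    the points of the grids of mesh [1 / (n + 1)], and these depend on
    [(sigma, r)] through countably many measurable conditions. *)
Lemma measurable_polar (u : HN -> R) : continuous u ->
  measurable_fun [set: dirs * measurableTypeR R] (fun p => u (polar p.2 p.1)).
Proof.
move=> cu.
pose z (n : nat) (p : dirs * measurableTypeR R) : 'rV[int]_N :=
  \row_i Num.floor (p.2 * tnth p.1 i * n.+1%:R).
pose grid (n : nat) (c : 'rV[int]_N) : HN := \row_i ((c ord0 i)%:~R / n.+1%:R).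
apply: (measurable_fun_cvg (h := fun n => (fun c => u (grid n c)) \o z n)).
  move=> n; apply: measurable_countable_valued => c.
  have -> : z n @^-1` [set c] = \bigcap_(i in [set: 'I_N])
      ((fun p : dirs * measurableTypeR R => p.2 * tnth p.1 i * n.+1%:R)
        @^-1` `[(c ord0 i)%:~R, (c ord0 i + 1)%:~R[).
    apply/seteqP; split => [p /= <- i _|p hp /=].
      by rewrite /preimage /= in_itv/= !mxE floor_itv.
    apply/rowP => i; rewrite mxE; apply: floor_def.
    by have := hp i I; rewrite /preimage /= in_itv.
  apply: fin_bigcap_measurable => // i _.
  rewrite -[X in measurable X]setTI; apply: measurable_funM => //.
  exact: measurable_coord.
move=> p _.
suff gz : grid n (z n p) @[n --> \oo] --> (polar p.2 p.1 : HN).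
  exact: cvg_comp gz (cu _).
apply/cvgrPdist_lt => e e0.
have := near_infty_natSinv_lt (PosNum e0); apply: filterS => n /= ne.
apply: le_lt_trans ne; apply: norm_row_le; first by rewrite invr_ge0.
move=> i; rewrite !mxE; set t := p.2 * tnth p.1 i.
have n0 : 0 < n.+1%:R :> R by rewrite ltr0n.
have /andP[h1 h2] := floor_itv (t * n.+1%:R).
rewrite intrD in h2.
have -> : t - (Num.floor (t * n.+1%:R))%:~R / n.+1%:R =
  (t * n.+1%:R - (Num.floor (t * n.+1%:R))%:~R) / n.+1%:R.
  by field; rewrite gt_eqF.
rewrite normrM (ger0_norm (x := n.+1%:R^-1)) ?invr_ge0 ?(ltW n0)//.
by rewrite ler_piMl ?invr_ge0 ?(ltW n0)// ger0_norm; lra.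
Qed.

Lemma polarE (r : R) (s : dirs) : polar r s = r *: (\row_i tnth s i : HN).
Proof. by apply/rowP => i; rewrite !mxE. Qed.

Definition unit_sphere : set dirs := [set s | tuple_norm s = 1].

Lemma measurable_unit_sphere : measurable unit_sphere.
Proof.
have -> : unit_sphere = @tuple_norm R N @^-1` [set 1].
  by apply/seteqP; split.
by rewrite -[X in measurable X]setTI; apply: measurable_tuple_norm.
Qed.

Lemma dist_polar (s : dirs) r : unit_sphere s -> 0 < r -> dist_pole (polar r s) = r.
Proof.
rewrite /unit_sphere/= /tuple_norm /dist_pole => s1 r0.
under eq_bigr do rewrite mxE exprMn.
by rewrite -mulr_sumr sqrtrM ?sqr_ge0// s1 mulr1 sqrtr_sqr gtr0_norm.
Qed.

Lemma unit_sphere_sum (s : dirs) : unit_sphere s -> \sum_(i < N) tnth s i ^+ 2 = 1.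
Proof.
rewrite /unit_sphere/= /tuple_norm => s1.
by rewrite -(sqr_sqrtr (sumr_ge0 _ (fun i _ => sqr_ge0 (tnth s i)))) s1 expr1n.
Qed.

Lemma unit_sphere_coord (s : dirs) i : unit_sphere s -> `|tnth s i| <= 1.
Proof.
move=> /unit_sphere_sum s1.
rewrite -(@ler_pXn2r _ 2) ?nnegrE// expr1n -normrX ger0_norm ?sqr_ge0// -s1.
by rewrite (bigD1 i)//= lerDl sumr_ge0// => j _; rewrite sqr_ge0.
Qed.

(** The cut-off at 0 matters: [u (r sigma)] with [r < 0] is the value of [u] in the
    opposite direction, and would not be supported in [[a, b]]. *)
Definition polar_family (u : HN -> R) (s : dirs) (r : R) : R :=
  if 0 < r then u (polar r s) else 0.

Local Notation partial i u := ('D_(delta_mx ord0 i) u).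

Lemma smooth_partial (u : HN -> R) i : smooth u -> smooth (partial i u).
Proof.
by move=> su s; have := su (rcons s i); rewrite /iter_partial foldr_rcons.
Qed.

Lemma smooth_continuous (u : HN -> R) : smooth u -> continuous u.
Proof. by move=> su; have [] := su [::]. Qed.

Lemma smooth_line_der (u : HN -> R) (s : dirs) : smooth u ->
  has_line_der u (\row_i tnth s i) (fun x => \sum_(i < N) tnth s i * partial i u x).
Proof.
move=> su.
have -> : (\row_i tnth s i : HN) = \sum_(i < N) tnth s i *: (delta_mx ord0 i : HN).
  rewrite [LHS]row_sum_delta; apply: eq_bigr => i _; by rewrite mxE.
apply: (@has_line_der_sum _ _ u _ (index_enum 'I_N) (fun i => tnth s i)
  (fun i => delta_mx ord0 i) (fun i => partial i u)).
- by move=> i; apply: has_line_der_derive => x; have [_ /(_ i x)] := su [::].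
- by move=> i; have := smooth_continuous (smooth_partial i su).
Qed.

Section supported_in_compact.
Context (C : set HN).
Hypotheses (cptC : compact C) (C0 : ~ C 0).

Let closedC : closed C.
Proof. by apply: compact_closed cptC; exact: norm_hausdorff. Qed.

Lemma compact_annulus : exists a b : R, [/\ 0 < a, a <= b &
  forall s, unit_sphere s -> forall r, 0 < r -> C (polar r s) -> a <= r <= b].
Proof.
have : nbhs (0 : HN) (~` C) by apply: open_nbhs_nbhs; split => //; exact: closed_openC.
move=> /nbhs_ballP[a /= a0 aC].
have [M [Mr hM]] := compact_bounded cptC.
pose M' := `|M| + 1.
have CM' x : C x -> `|x| <= M' by apply: hM; rewrite (le_lt_trans (ler_norm M)) ?ltrDl.
have M'0 : 0 <= M' by rewrite addr_ge0.
exists a, (a + N%:R * M'); split => //; first by rewrite lerDl mulr_ge0.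
move=> s Ss r r0 Cr; apply/andP; split.
  rewrite leNgt; apply/negP => ra; apply: (aC _ _ Cr).
  rewrite -ball_normE /= sub0r normrN; apply: le_lt_trans ra.
  apply: norm_row_le; first exact: ltW.
  by move=> i; rewrite mxE normrM gtr0_norm// ler_piMr ?(ltW r0)// unit_sphere_coord.
apply: (@le_trans _ _ (N%:R * M')); last by rewrite lerDr ltW.
have r2 : r ^+ 2 <= N%:R * M' ^+ 2.
  have -> : r ^+ 2 = \sum_(i < N) r ^+ 2 * tnth s i ^+ 2.
    by rewrite -mulr_sumr unit_sphere_sum// mulr1.
  apply: le_trans (_ : _ <= \sum_(i < N) M' ^+ 2) _; last first.
    by rewrite sumr_const card_ord -[leLHS]mulr_natl.
  apply: ler_sum => i _; rewrite -exprMn -[X in X <= _]ger0_norm ?sqr_ge0// normrX.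
  rewrite lerXn2r ?nnegrE//; apply: le_trans (CM' _ Cr).
  by have := norm_coord_le (polar r s) i; rewrite mxE.
have N1 : 1 <= N%:R :> R.
  rewrite ler1n lt0n; apply/eqP => N0; move: r2; rewrite N0 mul0r.
  by rewrite leNgt exprn_gt0.
have NM0 : 0 <= N%:R * M' by rewrite mulr_ge0.
rewrite -(@ler_pXn2r _ 2) ?nnegrE ?(ltW r0)//.
apply: le_trans r2 _; rewrite exprMn ler_wpM2r ?sqr_ge0// expr2 ler_peMl//.
Qed.

Lemma partial_off_support (u : HN -> R) i : (forall x, ~ C x -> u x = 0) ->
  forall x, ~ C x -> partial i u x = 0.
Proof.
move=> u0 x Cx.
have h : \forall y \near x, u y = (fun=> 0) y.
  have : nbhs x (~` C) by apply: open_nbhs_nbhs; split => //; exact: closed_openC.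
  by apply: filterS => y; exact: u0.
transitivity ('D_(delta_mx ord0 i) (fun=> 0 : R) x); last exact: derive_cst.
exact: near_eq_derive h.
Qed.

Context (a b : R).
Hypotheses (a_gt0 : 0 < a) (a_le_b : a <= b).
Hypothesis annulus : forall s, unit_sphere s -> forall r, 0 < r ->
  C (polar r s) -> a <= r <= b.

Lemma polar_family_der (u : HN -> R) s r : smooth u ->
  (forall x, ~ C x -> u x = 0) -> unit_sphere s ->
  has_der r (polar_family u s)
    (\sum_(i < N) tnth s i * polar_family (partial i u) s r).
Proof.
move=> su u0 Ss; have [r0|r0] := ltP 0 r.
  have := smooth_line_der s su 0 r; rewrite add0r -polarE => dr.
  have -> : \sum_(i < N) tnth s i * polar_family (partial i u) s r =
      \sum_(i < N) tnth s i * partial i u (polar r s).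
    by apply: eq_bigr => i _; rewrite /polar_family r0.
  apply: der_near dr; near=> t; rewrite add0r -polarE /polar_family ifT//.
  by near: t; exact: lt_nbhsr.
have -> : \sum_(i < N) tnth s i * polar_family (partial i u) s r = 0.
  by apply: big1 => i _; rewrite /polar_family ltNge r0/= mulr0.
apply: der_near (der_cst r 0); near=> t; rewrite /polar_family.
case: ifPn => // t0; rewrite u0// => Ct; have /andP[at_ _] := annulus Ss t0 Ct.
have : t < a by near: t; apply: lt_nbhsl; exact: le_lt_trans a_gt0.
by rewrite ltNge at_.
Unshelve. all: by end_near. Qed.

Lemma polar_family_bounded (u : HN -> R) : smooth u ->
  (forall x, ~ C x -> u x = 0) ->
  bounded_family unit_sphere a b (polar_family u).
Proof.
move=> su u0; split.
- move=> s Ss r hr; rewrite /polar_family; case: ifPn => // r0.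
  by rewrite u0// => /(annulus Ss r0); apply/negP.
- by move=> s Ss r; exact: der_continuous (polar_family_der r su u0 Ss).
- have cu : {within C, continuous u} by apply: continuous_subspaceT; exact: smooth_continuous.
  have [M [Mr hM]] := compact_bounded (continuous_compact cu cptC).
  exists (`|M| + 1) => s Ss r; rewrite /polar_family; case: ifPn => r0; last first.
    by rewrite normr0 addr_ge0.
  have [Cr|Cr] := pselect (C (polar r s)); last by rewrite u0// normr0 addr_ge0.
  apply: hM; last by exists (polar r s).
  by rewrite (le_lt_trans (ler_norm M)) ?ltrDl.
- apply: (measurable_funS (E := setT)) => //.
  apply: (measurable_fun_ifT (g := fun p => u (polar p.2 p.1)) (h := fun=> 0)).
  + by apply: measurable_fun_ltr => //; exact: measurable_snd.
  + exact: measurable_polar (smooth_continuous su).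
  + exact: measurable_cst.
Qed.

(** The derivative of the family of [u] is the combination, with coefficients the
    coordinates of [sigma], of the families of its partial derivatives, which are
    again smooth and supported in [C]; hence induction. *)
Lemma polar_family_smooth (u : HN -> R) : smooth u ->
  (forall x, ~ C x -> u x = 0) ->
  smooth_family unit_sphere a b (polar_family u).
Proof.
move=> + + n; elim: n u => [|n IH] u su u0.
  by split => //; exact: polar_family_bounded.
split; first exact: polar_family_bounded.
split.
  move=> s Ss r; rewrite (derive1_der (polar_family_der r su u0 Ss)).
  exact: polar_family_der.
have H : regular_family unit_sphere a b n
    (fun s r => \sum_(i < N) tnth s i * polar_family (partial i u) s r).
  apply: regular_family_sum => i.
  apply: (regular_family_scale (c := fun s => tnth s i) (phi := polar_family (partial i u))).
  - exact: measurable_tnth.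
  - by exists 1 => s Ss; exact: unit_sphere_coord.
  - by apply: IH; [exact: smooth_partial|exact: partial_off_support].
apply: regular_family_eq H => s Ss; apply/funext => r.
by rewrite (derive1_der (polar_family_der r su u0 Ss)).
Qed.

End supported_in_compact.
End row_vectors.

(** * The surface measure *)

Section full_measure.
Import HBNNSimple.
Context d (T : measurableType d) (R : realType).
Variable mu : {measure set T -> \bar R}.
Local Open Scope ereal_scope.

(** The integrand of [hyp_integral] is controlled on the unit sphere only, so the
    argument is made on the simple functions below [f]: cutting one of them off
    outside [A] does not change its integral. *)
Lemma ge0_integral_full (A : set T) (f : T -> \bar R) : measurable A ->
  mu (~` A) = 0 -> (forall x, 0 <= f x) ->
  \int[mu]_x f x = \int[mu]_(x in A) f x.
Proof.
move=> mA A0 f0; rewrite [RHS]integral_mkcond.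
have fA0 x : 0 <= (f \_ A) x by apply: erestrict_ge0.
rewrite !ge0_integralTE//; apply/eqP; rewrite eq_le; apply/andP; split.
- apply: ge_ereal_sup => _ [h hf <-]; apply: ereal_sup_ubound.
  exists (proj_nnsfun h mA).
    move=> x /=; rewrite patchE mindicE; case: (boolP (x \in A)) => xA.
      by rewrite mulr1; exact: hf.
    by rewrite mulr0.
  rewrite -!integralT_nnsfun.
  have mh : measurable_fun [set: T] (EFin \o h).
    by apply/measurable_EFinP; exact: measurable_funPT.
  rewrite [RHS](ge0_negligible_integral (N := ~` A))//; last 2 first.
  + exact: measurableC.
  + by move=> x _; rewrite lee_fin.
  rewrite setTD setCK [RHS]integral_mkcond; apply: eq_integral => x _ /=.
  rewrite patchE mindicE; case: (boolP (x \in A)) => xA.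
    by rewrite mulr1.
  by rewrite mulr0.
- apply: ereal_sup_le => _ [h hf <-]; exists h => // x.
  apply: le_trans (hf x) _; rewrite patchE; case: ifP => // _; exact: f0.
Qed.

End full_measure.

Section sphere_measure_facts.
Context (R : realType) (N : nat).
Local Notation dirs := (N.-tuple (measurableTypeR R)).

Lemma sphere_measure_unit_sphere :
  sphere_measure R N (~` @unit_sphere R N) = 0%E.
Proof.
rewrite /sphere_measure /= /mscale /= /cone_measure /pushforward /mrestr.
rewrite (_ : _ `&` _ = set0) ?measure0 ?mule0//.
apply/seteqP; split => // t [/= nt /andP[t0 _]]; apply: nt.
rewrite /unit_sphere /= {1}/tuple_norm /tuple_dir.
under eq_bigr do rewrite tnth_mktuple expr_div_n.
rewrite -mulr_suml sqrtrM ?sumr_ge0//; last by move=> i _; rewrite sqr_ge0.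
rewrite -/(tuple_norm t) sqrtrV ?sqr_ge0// sqrtr_sqr gtr0_norm//.
by rewrite divff// gt_eqF.
Qed.

Definition unit_cube n : set (n.-tuple (measurableTypeR R)) :=
  [set t | forall i, `|tnth t i| <= 1].

Lemma unit_cubeS n : @unit_cube n.+1 =
  @uncons_pair R n @^-1` (`[-1, 1]%classic `*` @unit_cube n).
Proof.
apply/seteqP; split => [t tc|t [/= h1 h2] i].
  split => /=.
    by rewrite in_itv/= -ler_norml; exact: tc.
  by move=> i; rewrite tnth_behead; exact: tc.
case: (unliftP ord0 i) => [j ->|->].
  have -> : lift ord0 j = inord j.+1.
    by apply: val_inj; rewrite /= inordK// ltnS ltn_ord.
  by have := h2 j; rewrite tnth_behead.
by move: h1; rewrite in_itv/= -ler_norml.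
Qed.

Lemma measurable_unit_cube n : measurable (@unit_cube n).
Proof.
elim: n => [|n IH].
  rewrite (_ : @unit_cube 0 = setT)//.
  by apply/seteqP; split => // t _ [].
rewrite unit_cubeS -[X in measurable X]setTI; apply: measurable_uncons_pair => //.
exact: measurableX.
Qed.

Lemma lebesgue_unit_cube n : (lebesgue_tuple R n (@unit_cube n) < +oo)%E.
Proof.
elim: n => [|n IH].
  by rewrite /= diracE ltey.
rewrite /= /lebesgue_cons /pushforward unit_cubeS -comp_preimage.
have -> : (@uncons_pair R n \o @cons_pair R n) = id.
  by apply/funext => p; exact: cons_pairK.
rewrite preimage_id product_measure1E//; last exact: measurable_unit_cube.
rewrite lte_mul_pinfty//.
by move: (@lebesgue_measure_itv R `[-1, 1]) => /= ->; case: ifP.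
Qed.

(** The unit ball lies in the cube of side 2. *)
Lemma sphere_measure_finite : (sphere_measure R N setT < +oo)%E.
Proof.
rewrite /sphere_measure /= /mscale /= /cone_measure /pushforward /mrestr.
rewrite preimage_setT setTI lte_mul_pinfty//.
apply: le_lt_trans (lebesgue_unit_cube N); apply: le_measure.
- by rewrite inE; exact: measurable_punctured_ball.
- by rewrite inE; exact: measurable_unit_cube.
move=> t /andP[t0 t1] i; apply: le_trans t1.
rewrite /tuple_norm -(sqrtr_sqr (tnth t i)) ler_sqrt; last first.
  by rewrite sumr_ge0// => j _; rewrite sqr_ge0.
by rewrite (bigD1 i)//= lerDl sumr_ge0// => j _; rewrite sqr_ge0.
Qed.

End sphere_measure_facts.

(** * Integration in polar coordinates *)

Section polar_integration.
Context (R : realType) (N : nat).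
Notation HN := 'rV[R]_N.
Local Notation dirs := (N.-tuple (measurableTypeR R)).
Local Notation S := (@unit_sphere R N).
Local Notation mu := (@lebesgue_measure R).
Context (a b : R).
Hypotheses (a_gt0 : 0 < a) (a_le_b : a <= b).
Implicit Types G : dirs -> R -> R.

Lemma bounded_family_half G s : bounded_family S a b G -> S s ->
  cont_pos (G s) /\ vanish_off a b (G s).
Proof. by move=> [v c _ _] Ss; split; [move=> r _; exact: c|exact: v]. Qed.

Lemma measurable_half_integral G : bounded_family S a b G ->
  (forall s r, S s -> 0 < r -> 0 <= G s r) ->
  measurable_fun S (fun s => (half_integral (G s))%:E).
Proof.
move=> bG G0; have [_ _ _ mG] := bG.
pose D : set (dirs * measurableTypeR R) := S `*` `]0, +oo[.
have mS : measurable S by exact: measurable_unit_sphere.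
have mD : measurable D by exact: measurableX.
pose g : dirs * measurableTypeR R -> R := (fun p => G p.1 p.2) \_ D.
have mg : measurable_fun [set: dirs * measurableTypeR R] g.
  apply/(measurable_restrictT _ mD); apply: measurable_funS mG.
    exact: measurableX.
  by move=> [s r] [].
have g0 p : (0 <= (g p)%:E)%E.
  rewrite lee_fin /g patchE; case: ifPn => //; rewrite inE => -[/= Ss].
  by rewrite in_itv/= andbT; exact: G0.
have mgE : measurable_fun [set: dirs * measurableTypeR R] (EFin \o g).
  exact/measurable_EFinP.
have := @measurable_fun_fubini_tonelli_F _ _ _ _ R mu _ mgE g0.
move=> /(measurable_funS (D := S) measurableT) h.
apply: eq_measurable_fun (h _) => // s; rewrite inE => Ss.
have [cG vG] := bounded_family_half bG Ss.
rewrite -(half_integralE a_gt0 cG vG) /fubini_F [RHS]integral_mkcond.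
apply: eq_integral => r _; rewrite /= /g !patchE.
have -> : ((s, r) \in D) = (r \in `]0, +oo[%classic).
  by apply/idP/idP; rewrite !inE; [case|split].
by case: ifP.
Qed.

Lemma half_integral_bounded G : bounded_family S a b G ->
  (forall s r, S s -> 0 < r -> 0 <= G s r) ->
  exists K : R, 0 <= K /\ forall s, S s -> half_integral (G s) <= K.
Proof.
move=> bG G0; have [v c [M bd] _] := bG.
exists (`|M| * fine (mu `[a, b])); split; first by rewrite mulr_ge0// fine_ge0.
move=> s Ss; have [cG vG] := bounded_family_half bG Ss.
have ab_pos r : a <= r <= b -> 0 < r by move=> /andP[ar _]; exact: lt_le_trans ar.
rewrite -lee_fin -(half_integralE a_gt0 cG vG).
have -> : (\int[mu]_(r in `]0%R, +oo[) (G s r)%:E = \int[mu]_(r in `[a, b]) (G s r)%:E)%E.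
  rewrite [LHS]integral_mkcond [RHS]integral_mkcond; apply: eq_integral => r _.
  rewrite !patchE; case: (boolP (r \in `[a, b]%classic)).
    by rewrite inE/= in_itv/= => /ab_pos r0; rewrite ifT// inE/= in_itv/= r0.
  rewrite notin_setE/= in_itv/= => /negP rab.
  by case: ifP => //; rewrite vG.
apply: (@le_trans _ _ (\int[mu]_(r in `[a, b]) (`|M|%:E))%E).
  apply: ge0_le_integral => //.
  - by move=> r; rewrite /= in_itv/= => /ab_pos r0; rewrite lee_fin G0.
  - apply/measurable_EFinP; apply: subspace_continuous_measurable_fun => //.
    by apply: continuous_subspaceT => r; exact: c.
  - by move=> r _; rewrite lee_fin (le_trans (ler_norm _))// (le_trans (bd _ Ss r))// ler_norm.
rewrite integral_cst// EFinM fineK//.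
by move: (@lebesgue_measure_itv R `[a, b]) => /= ->; case: ifP.
Qed.

Lemma sphere_integral_finite G : bounded_family S a b G ->
  (forall s r, S s -> 0 < r -> 0 <= G s r) ->
  (\int[sphere_measure R N]_(s in S) (half_integral (G s))%:E < +oo)%E.
Proof.
move=> bG G0; have [K [K0 hK]] := half_integral_bounded bG G0.
have mS : measurable S by exact: measurable_unit_sphere.
apply: (@le_lt_trans _ _ (\int[sphere_measure R N]_(s in S) (K%:E))%E).
  apply: ge0_le_integral => //.
  - move=> s Ss; rewrite lee_fin; apply: Rintegral_ge0 => r.
    by rewrite /= in_itv/= andbT; exact: G0.
  - exact: measurable_half_integral.
rewrite integral_cst// lte_mul_pinfty// ?lee_fin//.
apply: le_lt_trans (sphere_measure_finite R N).
by apply: le_measure => //; rewrite inE.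
Qed.

Lemma hyp_integralE (F : HN -> R) G : bounded_family S a b G ->
  (forall x, 0 <= F x) ->
  (forall s r, S s -> 0 < r -> F (polar r s) * vol N r = G s r) ->
  hyp_integral F = (\int[sphere_measure R N]_(s in S) (half_integral (G s))%:E)%E.
Proof.
move=> bG F0 FG; rewrite /hyp_integral (@ge0_integral_full _ _ _ _ S).
- apply: eq_integral => s; rewrite inE => Ss.
  have [cG vG] := bounded_family_half bG Ss.
  rewrite -(half_integralE a_gt0 cG vG); apply: eq_integral => r.
  by rewrite inE/= in_itv/= andbT => r0; rewrite -(FG s r Ss r0).
- exact: measurable_unit_sphere.
- exact: sphere_measure_unit_sphere.
- move=> s; apply: integral_ge0 => r; rewrite /= in_itv/= andbT => r0.
  by rewrite lee_fin mulr_ge0// vol_ge0.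
Qed.

End polar_integration.

Section radial_operators.
Context (R : realType) (N : nat).
Notation HN := 'rV[R]_N.
Local Notation dirs := (N.-tuple (measurableTypeR R)).
Implicit Types (F : HN -> R) (s : dirs) (f : R -> R).

Definition nabla1 (n : nat) f : R -> R :=
  if odd n then derive1 (iter n./2 (radial_laplacian1 N) f)
  else iter n./2 (radial_laplacian1 N) f.

(** At [r sigma] both sides are limits of the same difference quotients. *)
Lemma radial_deriv_polar F f s : unit_sphere s ->
  (forall r, 0 < r -> F (polar r s) = f r) ->
  forall r, 0 < r -> radial_deriv F (polar r s) = derive1 f r.
Proof.
move=> Ss Ff r r0; rewrite /radial_deriv dist_polar// polarE scalerA mulVf ?gt_eqF//.
rewrite scale1r -polarE.
have <- : derive1 (fun t => F (polar t s)) r = derive1 f r.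
  apply: derive1_near; near=> t.
  have t0 : 0 < t by near: t; exact: lt_nbhsr.
  exact: Ff.
rewrite derive1E /derive.
set g1 := (fun h : R => _); set g2 := (fun h : R => _).
suff -> : g1 = g2 by [].
by apply/funext => h; rewrite /g1 /g2 /= scaler1 !polarE -scalerDl.
Unshelve. all: by end_near. Qed.

Lemma radial_laplacian_polar F f s : unit_sphere s ->
  (forall r, 0 < r -> F (polar r s) = f r) ->
  forall r, 0 < r -> radial_laplacian F (polar r s) = radial_laplacian1 N f r.
Proof.
move=> Ss Ff r r0; rewrite /radial_laplacian /radial_laplacian1 dist_polar//.
have Fd := radial_deriv_polar Ss Ff.
by rewrite (radial_deriv_polar Ss Fd)// Fd.
Qed.

Lemma nabla_polar n F f s : unit_sphere s ->
  (forall r, 0 < r -> F (polar r s) = f r) ->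
  forall r, 0 < r -> nabla_r n F (polar r s) = nabla1 n f r.
Proof.
move=> Ss Ff.
have it m r : 0 < r -> iter m (@radial_laplacian R N) F (polar r s) =
    iter m (radial_laplacian1 N) f r.
  elim: m r => [|m IH] r r0; first exact: Ff.
  by rewrite !iterS; exact: (radial_laplacian_polar Ss IH).
rewrite /nabla_r /nabla1; case: ifP => _ r r0; last exact: it.
exact: (radial_deriv_polar Ss (it _)).
Qed.

Lemma energy1_nabla1 n f :
  energy1 (radial_laplacian1 N) (@hardy_integral R N) (@gradient_integral R N) n f
  = half_integral (fun r => nabla1 n f r ^+ 2 * vol N r).
Proof.
rewrite /energy1 /nabla1; case: ifP => // _; congr half_integral.
by apply/funext => r; rewrite muln0 expr0 mulr1.
Qed.

End radial_operators.

(** * The inequality for test functions *)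

Section test_functions.
Context (R : realType) (N : nat).
Notation HN := 'rV[R]_N.
Local Notation dirs := (N.-tuple (measurableTypeR R)).
Local Notation S := (@unit_sphere R N).
Hypothesis N_ge7 : (7 <= N)%N.

Lemma test_function_polar (u : HN -> R) : test_function u ->
  exists a b, [/\ 0 < a, a <= b & smooth_family S a b (polar_family u)].
Proof.
move=> [su cptC C0].
have u0 x : ~ closure [set x | u x != 0] x -> u x = 0.
  move=> Cx; apply: contrapT => /eqP ux; apply: Cx; exact: subset_closure.
have [a [b [a0 ab ann]]] := compact_annulus cptC C0.
by exists a, b; split => //; exact: (polar_family_smooth cptC a0 ann).
Qed.

Section one_test_function.
Context (u : HN -> R) (a b : R).
Hypotheses (a_gt0 : 0 < a) (a_le_b : a <= b).
Hypothesis uab : smooth_family S a b (polar_family u).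
Local Notation phi := (polar_family u).

Lemma nabla1_bounded n : bounded_family S a b (fun s => nabla1 N n (phi s)).
Proof.
have it m : smooth_family S a b (fun s => iter m (radial_laplacian1 N) (phi s)).
  by elim: m => [//|m IH]; exact: (smooth_family_laplacian a_gt0 a_le_b N IH).
rewrite /nabla1; case: (odd n).
  exact: regular_family_bounded (smooth_family_derive (it n./2) 0).
exact: regular_family_bounded (it n./2 0%N).
Qed.

Let cont_pos_vol : cont_pos (@vol R N).
Proof. exact: cont_pos_der (der_vol N_ge7). Qed.

Let energy_density n s r := nabla1 N n (phi s) r ^+ 2 * vol N r.
Let hardy_density j s r := phi s r ^+ 2 * r^-1 ^+ (2 * j) * vol N r.

Let energy_densityP n : bounded_family S a b (energy_density n).
Proof.
apply: bounded_family_eq (bounded_family_mul a_gt0 a_le_b cont_pos_vol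
  (bounded_family_prod (nabla1_bounded n) (nabla1_bounded n))) => s _.
by apply/funext => r; rewrite /energy_density; ring.
Qed.

Let hardy_densityP j : bounded_family S a b (hardy_density j).
Proof.
have bphi : bounded_family S a b phi := regular_family_bounded (uab 0).
have cw : cont_pos (fun r : R => r^-1 ^+ (2 * j) * vol N r).
  apply: cont_pos_mul cont_pos_vol.
  by apply: cont_pos_der => r r0; exact: der_inv_exp.
apply: bounded_family_eq (bounded_family_mul a_gt0 a_le_b cw
  (bounded_family_prod bphi bphi)) => s _.
by apply/funext => r; rewrite /hardy_density; ring.
Qed.

Let energy_density_ge0 n s r : S s -> 0 < r -> 0 <= energy_density n s r.
Proof. by move=> _ r0; rewrite mulr_ge0 ?sqr_ge0// vol_ge0. Qed.

Let hardy_density_ge0 j s r : S s -> 0 < r -> 0 <= hardy_density j s r.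
Proof.
move=> _ r0; rewrite mulr_ge0 ?vol_ge0// mulr_ge0 ?sqr_ge0//.
by rewrite exprn_ge0// invr_ge0 ltW.
Qed.

Let phiE s : S s -> forall r, 0 < r -> u (polar r s) = phi s r.
Proof. by move=> _ r r0; rewrite /polar_family r0. Qed.

Lemma energyE n : energy n u =
  (\int[sphere_measure R N]_(s in S) (half_integral (energy_density n s))%:E)%E.
Proof.
apply: (hyp_integralE a_gt0 (energy_densityP n)) => [x|s r Ss r0].
  exact: sqr_ge0.
by rewrite (nabla_polar n Ss (phiE Ss)).
Qed.

Lemma hardy_termE j : hardy_term j u =
  (\int[sphere_measure R N]_(s in S) (half_integral (hardy_density j s))%:E)%E.
Proof.
apply: (hyp_integralE a_gt0 (hardy_densityP j)) => [x|s r Ss r0].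
  by rewrite divr_ge0 ?sqr_ge0// exprn_ge0// sqrtr_ge0.
by rewrite (phiE Ss)// dist_polar// -exprVn.
Qed.

(** The energy of order [l] is finite, so it can be moved to the left-hand side, where
    all terms are integrals of nonnegative functions. *)
Lemma integrate_hardy_bound k l (lam : R) (Z : nat -> R) :
  0 <= lam -> (forall j, 0 <= Z j) ->
  (forall s, S s ->
    \sum_(1 <= j < k.+1) Z j * half_integral (hardy_density j s)
    + lam * half_integral (energy_density l s)
    <= half_integral (energy_density k s)) ->
  (\sum_(1 <= j < k.+1) (Z j)%:E * hardy_term j u
    <= energy k u - lam%:E * energy l u)%E.
Proof.
move=> lam0 Z0 pointwise.
have mS : measurable S by exact: measurable_unit_sphere.
have mE n := measurable_half_integral a_gt0 (energy_densityP n) (@energy_density_ge0 n).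
have mH j := measurable_half_integral a_gt0 (hardy_densityP j) (@hardy_density_ge0 j).
have half_ge0 (G : dirs -> R -> R) : (forall s r, S s -> 0 < r -> 0 <= G s r) ->
    forall s, S s -> (0 <= (half_integral (G s))%:E)%E.
  move=> G0 s Ss; rewrite lee_fin; apply: Rintegral_ge0 => r.
  by rewrite /= in_itv/= andbT; exact: G0.
have E0 n := half_ge0 _ (@energy_density_ge0 n).
have H0 j := half_ge0 _ (@hardy_density_ge0 j).
have El0 : (0 <= energy l u)%E.
  by rewrite energyE; apply: integral_ge0 => s Ss; exact: E0.
have Elfin : energy l u \is a fin_num.
  rewrite ge0_fin_numE// energyE.
  exact: (sphere_integral_finite a_gt0 (energy_densityP l) (@energy_density_ge0 l)).
rewrite leeBrDr ?fin_numM//.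
rewrite (eq_bigr (fun j => (\int[sphere_measure R N]_(s in S)
    ((Z j)%:E * (half_integral (hardy_density j s))%:E))%E)); last first.
  move=> j _; rewrite hardy_termE ge0_integralZl//; last by rewrite lee_fin.
  exact: H0.
rewrite !energyE -ge0_integralZl ?lee_fin//; last exact: E0.
rewrite -ge0_integral_sum//; last 2 first.
- by move=> j; exact: measurable_funeM.
- by move=> j s Ss; rewrite mule_ge0 ?lee_fin//; have := H0 j s Ss; rewrite lee_fin.
have mZE : measurable_fun S
    (fun s => (lam%:E * (half_integral (energy_density l s))%:E)%E).
  exact: measurable_funeM.
have mZH : measurable_fun S (fun s => (\sum_(1 <= j < k.+1)
    (Z j)%:E * (half_integral (hardy_density j s))%:E)%E).
  by apply: emeasurable_sum => j; exact: measurable_funeM.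
have ZH0 s : S s -> (0 <= \sum_(1 <= j < k.+1)
    (Z j)%:E * (half_integral (hardy_density j s))%:E)%E.
  by move=> Ss; apply: sume_ge0 => j _; rewrite mule_ge0 ?lee_fin//;
     have := H0 j s Ss; rewrite lee_fin.
have ZE0 s : S s -> (0 <= lam%:E * (half_integral (energy_density l s))%:E)%E.
  by move=> Ss; rewrite mule_ge0 ?lee_fin//; have := E0 l s Ss; rewrite lee_fin.
rewrite -ge0_integralD//; apply: ge0_le_integral => //.
- by move=> s Ss; rewrite adde_ge0 ?ZH0 ?ZE0.
- exact: emeasurable_funD.
- move=> s Ss; apply: le_trans (_ : _ <= (\sum_(1 <= j < k.+1)
      Z j * half_integral (hardy_density j s)
      + lam * half_integral (energy_density l s))%:E)%E _; last first.
    by rewrite lee_fin pointwise.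
  by rewrite EFinD -sumEFin EFinM.
Qed.

Lemma polar_profile s : S s -> profile S (phi s).
Proof. by move=> Ss; exists a, b, phi, s. Qed.

End one_test_function.
End test_functions.

Theorem corollary4p2 (R : realType) (N k l : nat)
    (l_gt0 : (0 < l)%N) (l_lt_k : (l < k)%N) (N_ge : (4 * k - 1 <= N)%N) :
  exists D : nat -> R,
    [/\ forall j : nat, (1 <= j <= k)%N -> 0 < D j,
        forall u : 'rV[R]_N -> R, test_function u ->
          (energy k u
             - ((((N%:R - 1) / 2) ^+ (2 * (k - l)) : R)%:E * energy l u)
           >= \sum_(1 <= j < k.+1) (D j)%:E * hardy_term j u)%E,
        D k = D_top R N k l
      & D 1%N = D_one R N k l].
Proof.
have N7 : (7 <= N)%N by lia.
have lk : (0 < l < k)%N by rewrite l_gt0.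
have [Z [Zpos ZQ Z1 Zk]] := profile_hardy_bound R (@unit_sphere R N) N7 lk N_ge.
exists Z; split => //; first by move=> j jk; have := Zpos j; rewrite jk.
move=> u tu; have [a [b [a0 ab uab]]] := test_function_polar tu.
have q0 : 0 <= (N%:R - 1) / 2 :> R.
  by rewrite divr_ge0// subr_ge0 ler1n; lia.
apply: (integrate_hardy_bound N7 a0 ab uab).
- by rewrite exprn_ge0.
- by move=> j; have := Zpos j; case: ifP => [_ /ltW|_ ->].
move=> s Ss; have := ZQ _ (polar_profile a0 ab uab Ss).
have Z0 : Z 0%N = 0 by have := Zpos 0%N.
rewrite big_ltn// Z0 mul0r add0r !energy1_nabla1 => h.
by rewrite -lerBrDr.
Qed.
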